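(* Let $V$ and $W$ be optimal prefix-free machines. Then the computation from $\mathrm{Pf}(\Omega_V)$ to $\operatorname{dom}W$ is unidirectional, and the computation from $\operatorname{dom}W$ to $\mathrm{Pf}(\Omega_V)$ is also unidirectional.
   Context: $\{0,1\}^*$ is the set of finite binary strings and $|x|$ is the length of $x$. A prefix-free machine is a partial recursive function $F\colon\{0,1\}^*\to\{0,1\}^*$ whose domain $\operatorname{dom}F$ is prefix-free. A prefix-free machine $V$ is optimal if for each prefix-free machine $F$ there exists $d\in\mathbb{N}$ such that for every $p\in\operatorname{dom}F$ there is $q\in\operatorname{dom}V$ with $V(q)=F(p)$ and $|q|\le|p|+d$. $\Omega_V=\sum_{p\in\operatorname{dom}V}2^{-|p|}$. For a real $\alpha$ and $n\in\mathbb{N}$, $\alpha\!\upharpoonright_n\in\{0,1\}^*$ denotes the first $n$ bits of the base-two expansion of $\alpha-\lfloor\alpha\rfloor$ with infinitely many zeros, and $\mathrm{Pf}(\alpha)=\{\alpha\!\upharpoonright_n\mid n\in\mathbb{N}\}\subset\{0,1\}^*$. For $f\colon\mathbb{N}\to\mathbb{N}$ and $A,B\subset\{0,1\}^*$, $A$ is reducible to $B$ in query size $f$ if there exists an oracle deterministic Turing machine $M$ such that $A$ is Turing reducible to $B$ via $M$ and, on every input $x\in\{0,1\}^*$, $M$ only queries strings of length at most $f(|x|)$. An order function is a non-decreasing total recursive function $f\colon\mathbb{N}\to\mathbb{N}$ with $\lim_{n\to\infty}f(n)=\infty$. For $A,B\subset\{0,1\}^*$, the computation from $A$ to $B$ is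 unidirectional if for all order functions $f$ and $g$: if $B$ is reducible to $A$ in query size $f$ and $A$ is reducible to $B$ in query size $g$, then the function $g(f(n))-n$ of $n\in\mathbb{N}$ is unbounded. *)

(* Defs.v *)
From mathcomp Require Import all_boot all_order all_algebra.
From mathcomp Require Import all_classical all_reals all_analysis.

Set Implicit Arguments.
Unset Strict Implicit.
Unset Printing Implicit Defensive.

Import Order.TTheory GRing.Theory Num.Theory.
Import numFieldNormedType.Exports.

Local Open Scope classical_set_scope.
Local Open Scope ring_scope.

Notation bits := (seq bool).

(* Kleene's partial recursive functions: [recfun n] is the type of schemes for
   partial functions from nat^n to nat, and [receval e xs y] says that the
   partial function given by [e] is defined at [xs] with value [y]. *)

Inductive recfun : nat -> Type :=
| Zero n : recfun n
| Succ : recfun 1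
| Proj n (i : 'I_n) : recfun n
| Comp n k (h : recfun k) (gs : 'I_k -> recfun n) : recfun n
| Prec n (g : recfun n) (h : recfun n.+2) : recfun n.+1
| Mu n (g : recfun n.+1) : recfun n.

Fixpoint receval n (e : recfun n) : n.-tuple nat -> nat -> Prop :=
  match e in recfun n return n.-tuple nat -> nat -> Prop with
  | Zero _ => fun _ y => y = 0%N
  | Succ => fun xs y => y = (thead xs).+1
  | Proj _ i => fun xs y => y = tnth xs i
  | Comp _ k h gs => fun xs y =>
      exists2 zs : k.-tuple nat,
        forall i, receval (gs i) xs (tnth zs i) & receval h zs y
  (* recursion on the first argument; the step scheme receives the
     predecessor, the previous value, and the parameters *)
  | Prec n g h => fun xs =>
      let params : n.-tuple nat := [tuple of behead xs] in
      (fix prec (m : nat) (y : nat) : Prop :=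
         match m with
         | 0 => receval g params y
         | m'.+1 => exists2 z, prec m' z &
                      receval h [tuple of m' :: z :: params] y
         end) (thead xs)
  | Mu _ g => fun xs y =>
      receval g [tuple of y :: xs] 0%N /\
      forall z, (z < y)%N -> exists w, receval g [tuple of z :: xs] w.+1
  end.

Definition total_recursive (f : nat -> nat) : Prop :=
  exists e : recfun 1, forall m n, receval e [tuple m] n <-> f m = n.

(* The bijection from binary strings to nat that enumerates them in
   length-lexicographic order: the empty string, 0, 1, 00, 01, ... *)
Definition string_code (x : bits) : nat :=
  foldl (fun m (b : bool) => (m.*2.+1 + b)%N) 0%N x.

Definition partial_recursive (F : bits -> option bits) : Prop :=
  exists e : recfun 1,
    forall x y, receval e [tuple string_code x] (string_code y) <-> F x = Some y.

Definition dom (F : bits -> option bits) : set bits := [set p | isSome (F p)].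

Definition prefix_free (A : set bits) : Prop :=
  forall p q, A p -> A q -> prefix p q -> p = q.

Definition prefix_free_machine (F : bits -> option bits) : Prop :=
  partial_recursive F /\ prefix_free (dom F).

Definition optimal (V : bits -> option bits) : Prop :=
  prefix_free_machine V /\
  forall F, prefix_free_machine F ->
    exists d : nat, forall p, dom F p ->
      exists q, [/\ dom V q, V q = F p & (size q <= size p + d)%N].

(* The sum is finite, by Kraft's inequality, whenever [dom V] is prefix-free. *)
Definition Omega (R : realType) (V : bits -> option bits) : R :=
  fine (\esum_(p in dom V) ((2^-1 ^+ size p : R)%:E))%E.

Definition binary_expansion (R : realType) (beta : R) (b : nat -> bool) : Prop :=
  (\sum_(0 <= i < n) (b i)%:R / 2 ^+ i.+1 : R) @[n --> \oo] --> beta.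

Definition infinitely_many_zeros (b : nat -> bool) : Prop :=
  forall m, exists2 i, (m <= i)%N & b i = false.

Definition Pf (R : realType) (alpha : R) : set bits :=
  [set x | exists b : nat -> bool,
     [/\ binary_expansion (alpha - (Num.floor alpha)%:~R) b,
         infinitely_many_zeros b
       & exists n, x = mkseq b n]].

(* Deterministic oracle Turing machines with one two-way infinite work tape,
   which initially holds the input, and one write-only query tape, which is
   erased after each query.  Work-tape symbols are the blank [None], the bits,
   and finitely many auxiliary symbols. *)

Inductive direction := Left | Stay | Right.

Inductive instruction (Q S : Type) : Type :=
| Halt (accept : bool)
| Query (yes no : Q)
(* next state, symbol written, head move, bit appended to the query tape *)
| Act of (S -> Q * S * direction * option bool).
Arguments Halt {Q S} accept.
Arguments Query {Q S} yes no.
Arguments Act {Q S} _.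

Record oracle_tm : Type := OracleTM {
  state : finType;
  aux : finType;
  start : state;
  instr : state -> instruction state (option (bool + aux))
}.

Definition symbol (M : oracle_tm) : Type := option (bool + aux M).

(* [cells_left] lists the cells to the left of the head, nearest first, and
   [cells_right] the scanned cell followed by those to its right; all cells
   beyond the lists are blank. *)
Record config (M : oracle_tm) : Type := Config {
  cur_state : state M;
  cells_left : seq (symbol M);
  cells_right : seq (symbol M);
  query_tape : bits
}.

Definition init (M : oracle_tm) (x : bits) : config M :=
  Config (start M) [::] [seq Some (inl b) | b <- x] [::].

Definition step (M : oracle_tm) (B : set bits) (c : config M) : config M :=
  let: Config q l r u := c in
  match instr q with
  | Halt _ => c
  | Query yes no => Config (if `[< B u >] then yes else no) l r [::]
  | Act delta =>
      let: (q', s, d, o) := delta (head None r) in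
      let u' := if o is Some b then rcons u b else u in
      match d with
      | Left => Config q' (behead l) (head None l :: s :: behead r) u'
      | Stay => Config q' l (s :: behead r) u'
      | Right => Config q' (s :: l) (behead r) u'
      end
  end.

Definition run (M : oracle_tm) (B : set bits) (x : bits) (t : nat) : config M :=
  iter t (step B) (init M x).

Definition turing_reduces_via (M : oracle_tm) (A B : set bits) : Prop :=
  forall x, exists t, instr (cur_state (run M B x t)) = Halt `[< A x >].

Definition queries (M : oracle_tm) (B : set bits) (x u : bits) : Prop :=
  exists t yes no, instr (cur_state (run M B x t)) = Query yes no /\
                   query_tape (run M B x t) = u.

Definition reducible_in_query_size (f : nat -> nat) (A B : set bits) : Prop :=
  exists M : oracle_tm, turing_reduces_via M A B /\
    forall x u, queries M B x u -> (size u <= f (size x))%N.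

Definition order_function (f : nat -> nat) : Prop :=
  [/\ {homo f : m n / (m <= n)%N}, total_recursive f
    & forall k, exists N, forall n, (N <= n)%N -> (k <= f n)%N].

Definition unbounded (h : nat -> int) : Prop :=
  forall c : nat, exists n, c%:Z < `|h n|.

(* The computation from A to B is unidirectional. *)
Definition unidirectional (A B : set bits) : Prop :=
  forall f g, order_function f -> order_function g ->
    reducible_in_query_size f B A -> reducible_in_query_size g A B ->
    unbounded (fun n => (g (f n))%:Z - n%:Z).

(* Main.v *)
Require Import Defs.
From mathcomp Require Import all_boot all_order all_algebra.
From mathcomp Require Import all_classical all_reals all_analysis.
From mathcomp Require Import finmap zify ring lra.

Set Implicit Arguments.
Unset Strict Implicit.
Unset Printing Implicit Defensive.

Import Order.TTheory GRing.Theory Num.Theory.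
Import numFieldNormedType.Exports.

(** The theorem follows from two bounds, valid for all optimal [V] and [W].

    First, if [dom W] is decided from the truncations of a real with queries of
    size [f], then [f n >= n - O(1)] ([halting_query_size]).  Otherwise, for
    each [k], let [n] be least with [f n <= n - 2k].  The first [f n] bits of
    the real determine which strings of length at most [n] are in [dom W], hence
    a string that no program of [W] of length at most [n] outputs.  Prefixing
    these bits with [k] in unary gives a description of that string of length
    [n - k + O(1)], which contradicts optimality for large [k].

    Second, if [Pf (Omega V)] is decided from [dom W] with queries of size [g],
    then [g n - n] is not bounded above ([omega_query_size]).  Suppose that
    [g n <= n + c].  At each stage of the enumeration of [dom W], the elements
    of length at most [j + c] found so far yield at most one guess for the first
    [j] bits of [Omega V], and the guess changes only when such an element is
    added.  So there are at most as many guesses of length [j] as halting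
    programs of length at most [j + c], plus one.  A guess of length [j] has
    measure [2^-j], and by Kraft's inequality the measures of all guesses of all
    lengths from 1 to [n] add up to at most a constant [2^(c+2)]
    ([size_candidates]).  Therefore the strings of length [n] all of whose
    nonempty prefixes are guesses form a fraction [O(1/n)] of all strings.  For
    [n = 4^e], the truncation of [Omega V] to [n] bits is one of them and is
    described by its position in an enumeration of them, which takes
    [n - 2e + O(1)] bits, together with [e] in unary.  But these [n] bits
    determine which programs of [V] shorter than [n] halt ([Omega_settles]), and
    hence a string that no such program outputs: a contradiction for large [e].

    As the bounds are monotone, [g (f n) >= g (n - O(1))] and
    [f (g n) >= g n - O(1)], and both exceed [n] by arbitrarily much.

    The two descriptions must be decoded by partial recursive functions.  A
    partial recursive function is handled through its stages, which are total
    computable functions ([stage_recfun]), and an unbounded search over stages is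
    partial recursive ([partial_recursive_search]); so only total functions on
    lists, pairs and finite types have to be programmed ([computable]).  The use
    of optimality is isolated in [no_short_certificate]. *)

(** * Recursive functions of natural numbers *)

Definition recursive n (f : n.-tuple nat -> nat) : Prop :=
  exists e : recfun n, forall xs y, receval e xs y <-> f xs = y.

Lemma recursive_ext n (f g : n.-tuple nat -> nat) :
  f =1 g -> recursive f -> recursive g.
Proof. by move=> fg [e He]; exists e => xs y; rewrite -fg. Qed.

Lemma recursive_zero n : recursive (fun _ : n.-tuple nat => 0).
Proof. by exists (Zero n) => xs y /=; split=> ->. Qed.

Lemma recursive_proj n (i : 'I_n) : recursive (fun xs => tnth xs i).
Proof. by exists (Proj i) => xs y /=; split=> ->. Qed.

Lemma recursive_comp n k (h : k.-tuple nat -> nat)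
    (g : 'I_k -> n.-tuple nat -> nat) :
  recursive h -> (forall i, recursive (g i)) ->
  recursive (fun xs => h [tuple g i xs | i < k]).
Proof.
case=> eh Hh Hg; have [eg Heg] := choice Hg.
exists (Comp eh eg) => xs y /=; split.
- case=> zs Hzs /Hh <-; congr h; apply: eq_from_tnth => i.
  by rewrite tnth_mktuple; apply/Heg.
- move=> <-; exists [tuple g i xs | i < k]; last by apply/Hh.
  by move=> i; rewrite tnth_mktuple; apply/Heg.
Qed.

Lemma recursive_prec n (g : n.-tuple nat -> nat) (h : n.+2.-tuple nat -> nat) :
  recursive g -> recursive h ->
  recursive (fun xs : n.+1.-tuple nat =>
    nat_rec (fun=> nat) (g [tuple of behead xs])
      (fun m z => h [tuple of m :: z :: [tuple of behead xs]]) (thead xs)).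
Proof.
case=> eg Hg [eh Hh]; exists (Prec eg eh) => xs /=.
elim: (thead xs) => [|m IHm] y /=; first exact: Hg.
split=> [[z /IHm -> /Hh]//|<-].
by eexists; [apply/IHm; reflexivity | apply/Hh].
Qed.

Lemma recursive_mu n (g : n.+1.-tuple nat -> nat) (f : n.-tuple nat -> nat) :
  recursive g ->
  (forall xs, g [tuple of f xs :: xs] = 0) ->
  (forall xs z, z < f xs -> g [tuple of z :: xs] != 0) ->
  recursive f.
Proof.
case=> e He f0 fmin; exists (Mu e) => xs y /=; split=> [[/He gy ltg]|<-].
  case: (ltngtP (f xs) y) => // [/ltg [w /He]|/fmin]; first by rewrite f0.
  by rewrite gy.
split=> [|z /fmin nz]; first by apply/He.
by exists (g [tuple of z :: xs]).-1; apply/He; rewrite prednK // lt0n.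
Qed.

Definition recursive2 (op : nat -> nat -> nat) : Prop :=
  recursive (fun xs : 2.-tuple nat => op (tnth xs ord0) (tnth xs ord_max)).

Lemma recursive2_comp n op (f g : n.-tuple nat -> nat) :
  recursive2 op -> recursive f -> recursive g ->
  recursive (fun xs => op (f xs) (g xs)).
Proof.
move=> Hop Hf Hg.
have Hfg (i : 'I_2) : recursive (if i == ord0 then f else g) by case: ifP.
apply: recursive_ext (recursive_comp Hop Hfg) => xs /=.
by rewrite !tnth_mktuple.
Qed.

Lemma total_recursiveP phi :
  total_recursive phi <-> recursive (fun xs : 1.-tuple nat => phi (thead xs)).
Proof.
split=> -[e He]; exists e.
  move=> xs y; rewrite -He.
  suff -> : xs = [tuple thead xs] by rewrite theadE.
  by case/tupleP: xs => x t; rewrite theadE; apply: val_inj; rewrite /= (tuple0 t).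
by move=> m n; rewrite He theadE.
Qed.

Lemma recursive1_comp n phi (f : n.-tuple nat -> nat) :
  total_recursive phi -> recursive f -> recursive (fun xs => phi (f xs)).
Proof.
move=> /total_recursiveP Hphi Hf.
apply: recursive_ext (recursive_comp Hphi (fun=> Hf)) => xs /=.
by rewrite [thead _]tnth_mktuple.
Qed.

Lemma total_recursive_succ : total_recursive succn.
Proof. by exists Succ => m n /=; split=> ->. Qed.

Lemma total_recursive_id : total_recursive id.
Proof. by apply/total_recursiveP; exact: (recursive_proj ord0). Qed.

Lemma total_recursive_comp phi psi :
  total_recursive phi -> total_recursive psi -> total_recursive (phi \o psi).
Proof.
move=> Hphi /total_recursiveP Hpsi; apply/total_recursiveP.
exact: (recursive1_comp Hphi Hpsi).
Qed.

Lemma total_recursive_cst c : total_recursive (fun=> c).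
Proof.
elim: c => [|c IHc]; first by apply/total_recursiveP; apply: recursive_zero.
exact: total_recursive_comp total_recursive_succ IHc.
Qed.

Lemma total_recursive2 op phi psi : recursive2 op ->
  total_recursive phi -> total_recursive psi ->
  total_recursive (fun m => op (phi m) (psi m)).
Proof.
move=> Hop /total_recursiveP Hphi /total_recursiveP Hpsi; apply/total_recursiveP.
exact: (recursive2_comp Hop Hphi Hpsi).
Qed.

Lemma recursive2_flip op : recursive2 op -> recursive2 (fun m n => op n m).
Proof.
by move=> Hop; exact: (recursive2_comp Hop (recursive_proj ord_max) (recursive_proj ord0)).
Qed.

Lemma recursive2_iter (phi : nat -> nat) (op : nat -> nat -> nat) :
  total_recursive phi -> recursive2 op ->
  recursive2 (fun m p => iter m (op p) (phi p)).
Proof.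
move=> /total_recursiveP Hphi Hop.
(* The step receives the predecessor, the previous value and the parameter. *)
have Hh : recursive (fun xs : 3.-tuple nat =>
    op (tnth xs (@Ordinal 3 2 isT)) (tnth xs (@Ordinal 3 1 isT))).
  by apply: recursive2_comp Hop _ _; exact: recursive_proj.
apply: recursive_ext (recursive_prec Hphi Hh) => xs /=.
have -> : tnth xs ord_max = thead [tuple of behead xs].
  by rewrite [RHS](tnth_nth 0) (tnth_nth 0) /= nth_behead.
have -> : tnth xs ord0 = thead xs by [].
elim: (thead xs) => [//|m IHm] /=.
by rewrite -IHm; congr op; rewrite (tnth_nth 0) [RHS](tnth_nth 0).
Qed.

Lemma recursive2_add : recursive2 addn.
Proof.
have Hs : recursive2 (fun _ z => z.+1).
  by apply: recursive1_comp total_recursive_succ _; exact: recursive_proj.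
apply: recursive_ext (recursive2_iter total_recursive_id Hs) => xs /=.
by elim: (tnth xs _) => //= m ->.
Qed.

Lemma recursive2_mul : recursive2 muln.
Proof.
apply: recursive_ext (recursive2_iter (total_recursive_cst 0) recursive2_add) => xs /=.
by elim: (tnth xs _) => //= m ->; rewrite mulSn.
Qed.

Lemma total_recursive_pred : total_recursive predn.
Proof.
have H : recursive (fun xs : 2.-tuple nat => tnth xs ord0) by exact: recursive_proj.
apply/total_recursiveP.
apply: recursive_ext (recursive_prec (recursive_zero 0) H) => xs /=.
by case: (thead xs) => //= m; rewrite (tnth_nth 0).
Qed.

Lemma recursive2_sub : recursive2 subn.
Proof.
have Hp : recursive2 (fun _ z => z.-1).
  by apply: recursive1_comp total_recursive_pred _; exact: recursive_proj.
suff H : recursive2 (fun m p => p - m) by exact: (recursive2_flip H).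
apply: recursive_ext (recursive2_iter total_recursive_id Hp) => xs /=.
by elim: (tnth xs ord0) => [|m] /=; [rewrite subn0|rewrite subnS => ->].
Qed.

(** A pairing function whose inverse only needs an integer square root. *)
Definition npair (a b : nat) : nat := (a + b) * (a + b) + a.
Definition nsqrt m : nat :=
  ex_minn (ex_intro (fun k => m < k.+1 * k.+1) m (leq_pmulr m.+1 (ltn0Sn m))).
Definition nfst m : nat := m - nsqrt m * nsqrt m.
Definition nsnd m : nat := nsqrt m - nfst m.

Lemma nsqrt_npair a b : nsqrt (npair a b) = a + b.
Proof.
rewrite /nsqrt /npair; case: ex_minnP => k Hk kmin.
have /kmin Hle : (a + b) * (a + b) + a < (a + b).+1 * (a + b).+1 by nia.
by apply/eqP; rewrite eqn_leq Hle /=; move: Hk; clear; nia.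
Qed.

Lemma nfst_npair a b : nfst (npair a b) = a.
Proof. by rewrite /nfst nsqrt_npair /npair addKn. Qed.

Lemma nsnd_npair a b : nsnd (npair a b) = b.
Proof. by rewrite /nsnd nfst_npair nsqrt_npair addKn. Qed.

Lemma recursive2_npair : recursive2 npair.
Proof.
have Hsq := recursive2_comp recursive2_mul recursive2_add recursive2_add.
exact: (recursive2_comp recursive2_add Hsq (recursive_proj ord0)).
Qed.

Lemma total_recursive_nsqrt : total_recursive nsqrt.
Proof.
apply/total_recursiveP.
have Hg : recursive2 (fun k m => m.+1 - k.+1 * k.+1).
  have Hp (i : 'I_2) := recursive1_comp total_recursive_succ (recursive_proj i).
  exact: (recursive2_comp recursive2_sub (Hp ord_max)
    (recursive2_comp recursive2_mul (Hp ord0) (Hp ord0))).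
apply: (recursive_mu Hg) => xs.
  rewrite !(tnth_nth 0) /= /nsqrt; case: ex_minnP => k.
  by rewrite /thead (tnth_nth 0) /= => lt_k _; apply/eqP; rewrite subn_eq0.
move=> z; rewrite /nsqrt; case: ex_minnP => k _ kmin zk.
rewrite subn_eq0; apply: contraL zk; rewrite -leqNgt !(tnth_nth 0) /= => lt_m.
by apply: kmin; rewrite /thead (tnth_nth 0).
Qed.

Lemma total_recursive_nfst : total_recursive nfst.
Proof.
apply: (total_recursive2 recursive2_sub) => //; first exact: total_recursive_id.
by apply: (total_recursive2 recursive2_mul); exact: total_recursive_nsqrt.
Qed.

Lemma total_recursive_nsnd : total_recursive nsnd.
Proof.
apply: (total_recursive2 recursive2_sub); first exact: total_recursive_nsqrt.
exact: total_recursive_nfst.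
Qed.

(** Once pairs are available, iteration of a unary function replaces primitive
    recursion: parameters and counters travel inside the iterated state. *)
Lemma total_recursive_iter phi : total_recursive phi ->
  total_recursive (fun m => iter (nsnd m) phi (nfst m)).
Proof.
move=> Hphi; have H : recursive2 (fun _ z => phi z).
  by apply: recursive1_comp Hphi _; exact: recursive_proj.
have := recursive2_iter total_recursive_id H.
move=> /total_recursive2; apply; first exact: total_recursive_nsnd.
exact: total_recursive_nfst.
Qed.

(** * Computable functions between encoded types *)

(** Decoding is never needed: a function is computable when some recursive
    function maps codes of arguments to codes of values, and injectivity of the
    code only serves to compute equality tests. *)
Class Enc (A : Type) := { enc : A -> nat; enc_inj : injective enc }.

#[export] Instance enc_nat : Enc nat := {| enc := id; enc_inj := @inj_id nat |}.

Lemma nat_of_bool_inj : injective nat_of_bool.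
Proof. by do 2![case]. Qed.
#[export] Instance enc_bool : Enc bool :=
  {| enc := nat_of_bool; enc_inj := nat_of_bool_inj |}.

Lemma enc_prod_inj A B {EA : Enc A} {EB : Enc B} :
  injective (fun u : A * B => npair (enc u.1) (enc u.2)).
Proof.
move=> [a b] [a' b'] /= E; congr (_, _); apply: enc_inj.
  by rewrite -(nfst_npair (enc a) (enc b)) E nfst_npair.
by rewrite -(nsnd_npair (enc a) (enc b)) E nsnd_npair.
Qed.
#[export] Instance enc_prod A B {EA : Enc A} {EB : Enc B} : Enc (A * B) :=
  {| enc := _; enc_inj := @enc_prod_inj A B EA EB |}.

Lemma enc_option_inj A {EA : Enc A} :
  injective (fun o : option A => if o is Some a then (enc a).+1 else 0).
Proof. by move=> [a|] [b|] // [] E; congr Some; exact: enc_inj. Qed.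
#[export] Instance enc_option A {EA : Enc A} : Enc (option A) :=
  {| enc := _; enc_inj := @enc_option_inj A EA |}.

Fixpoint seq_enc A {EA : Enc A} (s : seq A) : nat :=
  if s is a :: s' then (npair (enc a) (seq_enc s')).+1 else 0.
Lemma seq_enc_inj A {EA : Enc A} : injective (@seq_enc A EA).
Proof.
elim=> [|a s IHs] [|b t] //= [E]; congr (_ :: _).
  by apply: enc_inj; rewrite -(nfst_npair (enc a) (seq_enc s)) E nfst_npair.
by apply: IHs; rewrite -(nsnd_npair (enc a) (seq_enc s)) E nsnd_npair.
Qed.
#[export] Instance enc_seq A {EA : Enc A} : Enc (seq A) :=
  {| enc := _; enc_inj := @seq_enc_inj A EA |}.

Lemma enc_fin_inj (T : finType) : injective (fun x : T => enum_rank x : nat).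
Proof. by move=> x y /ord_inj /enum_rank_inj. Qed.
(* The low priority keeps the codes of [bool] and of products and options of
   finite types structural. *)
#[export] Instance enc_fin (T : finType) : Enc T | 100 :=
  {| enc := _; enc_inj := @enc_fin_inj T |}.

Definition computable A B {EA : Enc A} {EB : Enc B} (f : A -> B) : Prop :=
  exists2 phi, total_recursive phi & forall a, phi (enc a) = enc (f a).

Section Basic.
Context {E A B C : Type} {EE : Enc E} {EA : Enc A} {EB : Enc B} {EC : Enc C}.

Lemma computable_ext (f g : A -> B) : f =1 g -> computable f -> computable g.
Proof. by move=> fg [phi Hphi Hf]; exists phi => // a; rewrite -fg. Qed.

Lemma computable_id : computable (fun a : A => a).
Proof. by exists id => //; exact: total_recursive_id. Qed.

Lemma computable_cst (b : B) : computable (fun _ : A => b).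
Proof. by exists (fun=> enc b) => //; exact: total_recursive_cst. Qed.

Lemma computable_comp (h : B -> C) (f : A -> B) :
  computable h -> computable f -> computable (fun a => h (f a)).
Proof.
move=> [psi Hpsi Hh] [phi Hphi Hf]; exists (psi \o phi).
  exact: total_recursive_comp.
by move=> a /=; rewrite Hf Hh.
Qed.

Lemma computable_pair (f : E -> A) (g : E -> B) :
  computable f -> computable g -> computable (fun e => (f e, g e)).
Proof.
move=> [phi Hphi Hf] [psi Hpsi Hg]; exists (fun m => npair (phi m) (psi m)).
  exact: (total_recursive2 recursive2_npair).
by move=> e; rewrite Hf Hg.
Qed.

Lemma computable_fst (f : E -> A * B) : computable f -> computable (fun e => (f e).1).
Proof.
move=> [phi Hphi Hf]; exists (nfst \o phi).
  exact: total_recursive_comp total_recursive_nfst Hphi.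
by move=> e /=; rewrite Hf [LHS]nfst_npair.
Qed.

Lemma computable_snd (f : E -> A * B) : computable f -> computable (fun e => (f e).2).
Proof.
move=> [phi Hphi Hf]; exists (nsnd \o phi).
  exact: total_recursive_comp total_recursive_nsnd Hphi.
by move=> e /=; rewrite Hf [LHS]nsnd_npair.
Qed.

Lemma computable_code (phi : nat -> nat) (f : A -> B) :
  computable phi -> (forall a, phi (enc a) = enc (f a)) -> computable f.
Proof.
move=> [psi Hpsi Hphi] Hf; exists psi => // a.
by rewrite -Hf; apply: Hphi.
Qed.

Lemma computable_enc (f : E -> A) : computable f -> computable (fun e => enc (f e)).
Proof. by case=> phi Hphi Hf; exists phi. Qed.

(** All loops reduce to this one.  Here and below, a function argument that
    depends on the environment [e] is taken uncurried, as a function of the pair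
    of [e] and its own argument. *)
Lemma computable_iter (n : E -> nat) (F : E -> A -> A) (x : E -> A) :
  computable n -> computable (fun p : E * A => F p.1 p.2) -> computable x ->
  computable (fun e => iter (n e) (F e) (x e)).
Proof.
move=> [phin Hn En] [phiF HF EF] [phix Hx Ex].
(* The iterated state is the environment paired with the accumulator. *)
have Hst : total_recursive (fun w => npair (nfst w) (phiF w)).
  exact: (total_recursive2 recursive2_npair total_recursive_nfst HF).
exists (fun m => nsnd ((fun w => iter (nsnd w) (fun w => npair (nfst w) (phiF w)) (nfst w))
    (npair (npair m (phix m)) (phin m)))).
  apply: (total_recursive_comp total_recursive_nsnd).
  apply: (total_recursive_comp (total_recursive_iter Hst)).
  apply: (total_recursive2 recursive2_npair) => //.
  exact: (total_recursive2 recursive2_npair total_recursive_id).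
move=> e; rewrite nfst_npair nsnd_npair En Ex /=.
have -> k : iter k (fun w => npair (nfst w) (phiF w)) (npair (enc e) (enc (x e))) =
    npair (enc e) (enc (iter k (F e) (x e))).
  elim: k => //= k ->; rewrite nfst_npair; congr npair.
  by rewrite -(EF (e, _)).
by rewrite nsnd_npair.
Qed.

End Basic.

Section Arithmetic.
Context {E A : Type} {EE : Enc E} {EA : Enc A}.

(** A conditional is a loop that runs zero or one times. *)
Lemma computable_if (b : E -> bool) (f g : E -> A) :
  computable b -> computable f -> computable g ->
  computable (fun e => if b e then f e else g e).
Proof.
move=> Hb Hf Hg.
have Hn : computable (fun e => nat_of_bool (b e)) := computable_enc Hb.
have HF : computable (fun p : E * A => f p.1).
  exact: computable_comp Hf (computable_fst computable_id).
by apply: computable_ext (computable_iter (F := fun e _ => f e) Hn HF Hg) => e; case: (b e).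
Qed.

Lemma computable_succ (f : E -> nat) : computable f -> computable (fun e => (f e).+1).
Proof.
case=> phi Hphi Hf; exists (succn \o phi); last by move=> e /=; rewrite Hf.
exact: total_recursive_comp total_recursive_succ Hphi.
Qed.

Lemma computable_pred (f : E -> nat) : computable f -> computable (fun e => (f e).-1).
Proof.
case=> phi Hphi Hf; exists (predn \o phi); last by move=> e /=; rewrite Hf.
exact: total_recursive_comp total_recursive_pred Hphi.
Qed.

Lemma computable_rec2 op (f g : E -> nat) : recursive2 op ->
  computable f -> computable g -> computable (fun e => op (f e) (g e)).
Proof.
move=> Hop [phi Hphi Hf] [psi Hpsi Hg]; exists (fun m => op (phi m) (psi m)).
  exact: total_recursive2.
by move=> e; rewrite Hf Hg.
Qed.

Lemma computable_addn (f g : E -> nat) :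
  computable f -> computable g -> computable (fun e => f e + g e).
Proof. exact: computable_rec2 recursive2_add. Qed.
Lemma computable_subn (f g : E -> nat) :
  computable f -> computable g -> computable (fun e => f e - g e).
Proof. exact: computable_rec2 recursive2_sub. Qed.
Lemma computable_muln (f g : E -> nat) :
  computable f -> computable g -> computable (fun e => f e * g e).
Proof. exact: computable_rec2 recursive2_mul. Qed.

End Arithmetic.

Lemma computable_leq {E} {EE : Enc E} (f g : E -> nat) :
  computable f -> computable g -> computable (fun e => f e <= g e).
Proof.
move=> Hf Hg.
have [phi Hphi Hfg] := computable_subn (computable_cst 1) (computable_subn Hf Hg).
exists phi => // e; rewrite Hfg /enc /= -subn_eq0.
by case: (f e - g e) => //= n; rewrite subn1.
Qed.

Lemma computable_negb {E} {EE : Enc E} (b : E -> bool) :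
  computable b -> computable (fun e => ~~ b e).
Proof.
move=> Hb; apply: computable_ext (computable_if Hb (computable_cst false) (computable_cst true)).
by move=> e; case: (b e).
Qed.

Lemma computable_andb {E} {EE : Enc E} (b c : E -> bool) :
  computable b -> computable c -> computable (fun e => b e && c e).
Proof. by move=> Hb Hc; exact: (computable_if Hb Hc (computable_cst false)). Qed.

Lemma computable_orb {E} {EE : Enc E} (b c : E -> bool) :
  computable b -> computable c -> computable (fun e => b e || c e).
Proof. by move=> Hb Hc; exact: (computable_if Hb (computable_cst true) Hc). Qed.

Lemma computable_eq {E} {EE : Enc E} {A : eqType} {EA : Enc A} (f g : E -> A) :
  computable f -> computable g -> computable (fun e => f e == g e).
Proof.
move=> Hf Hg; have Hf' := computable_enc Hf; have Hg' := computable_enc Hg.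
apply: computable_ext (computable_andb (computable_leq Hf' Hg') (computable_leq Hg' Hf')) => e.
by rewrite -eqn_leq (inj_eq enc_inj).
Qed.

Lemma computable_nat_case {E A} {EE : Enc E} {EA : Enc A}
    (n : E -> nat) (f : E -> nat -> A) (g : E -> A) :
  computable n -> computable (fun p : E * nat => f p.1 p.2) -> computable g ->
  computable (fun e => if n e is m.+1 then f e m else g e).
Proof.
move=> Hn Hf Hg.
have Hf' := computable_comp Hf (computable_pair computable_id (computable_pred Hn)).
apply: computable_ext (computable_if
  (computable_eq Hn (computable_cst 0)) Hg Hf') => e.
by case: (n e).
Qed.

Lemma computable_Some {E A} {EE : Enc E} {EA : Enc A} (f : E -> A) :
  computable f -> computable (fun e => Some (f e)).
Proof.
move=> /computable_enc /computable_succ [phi Hphi Hf].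
by exists phi.
Qed.

Lemma computable_oapp {E A B} {EE : Enc E} {EA : Enc A} {EB : Enc B}
    (f : E -> A -> B) (x : E -> B) (o : E -> option A) :
  computable (fun p : E * A => f p.1 p.2) -> computable x -> computable o ->
  computable (fun e => oapp (f e) (x e) (o e)).
Proof.
move=> [phif Hphif Hf] [phix Hphix Hx] [phio Hphio Ho].
have [phi Hphi Hcase] :
    computable (fun m => if phio m is k.+1 then phif (npair m k) else phix m).
  apply: (computable_nat_case (f := fun m k => phif (npair m k))).
  - by exists phio.
  - have Hc : computable (phif : nat -> nat) by exists phif.
    apply: (computable_comp Hc); apply: (computable_rec2 recursive2_npair).
      exact: computable_fst computable_id.
    exact: computable_snd computable_id.
  - by exists phix.
exists phi => // e; rewrite [LHS]Hcase /= Ho; case: (o e) => [a|] /=; last exact: Hx.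
exact: (Hf (e, a)).
Qed.

Lemma computable_cons {E A} {EE : Enc E} {EA : Enc A} (f : E -> A) (s : E -> seq A) :
  computable f -> computable s -> computable (fun e => f e :: s e).
Proof.
move=> Hf Hs; have [phi Hphi H] :=
  computable_succ (computable_rec2 recursive2_npair (computable_enc Hf) (computable_enc Hs)).
by exists phi.
Qed.

Lemma computable_ohead {E A} {EE : Enc E} {EA : Enc A} (s : E -> seq A) :
  computable s -> computable (fun e => ohead (s e)).
Proof.
move=> Hs; apply: (computable_comp _ Hs).
apply: (@computable_code _ _ _ _ (fun n => if n is m.+1 then (nfst m).+1 else 0)); last first.
  by case=> //= a t; rewrite nfst_npair.
apply: (computable_nat_case (f := fun _ m => (nfst m).+1)); first exact: computable_id.
  apply: computable_succ.
  have H : computable nfst by exists nfst => //; exact: total_recursive_nfst.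
  exact: computable_comp H (computable_snd computable_id).
exact: computable_cst.
Qed.

Lemma computable_behead {E A} {EE : Enc E} {EA : Enc A} (s : E -> seq A) :
  computable s -> computable (fun e => behead (s e)).
Proof.
move=> Hs; apply: (computable_comp _ Hs).
apply: (@computable_code _ _ _ _ (fun n => if n is m.+1 then nsnd m else 0)); last first.
  by case=> //= a t; rewrite nsnd_npair.
apply: (computable_nat_case (f := fun _ m => nsnd m)); first exact: computable_id.
  have H : computable nsnd by exists nsnd => //; exact: total_recursive_nsnd.
  exact: computable_comp H (computable_snd computable_id).
exact: computable_cst.
Qed.

Lemma computable_app2 {E A B C} {EE : Enc E} {EA : Enc A} {EB : Enc B} {EC : Enc C}
    (F : A -> B -> C) (f : E -> A) (g : E -> B) :
  computable (fun p : A * B => F p.1 p.2) -> computable f -> computable g ->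
  computable (fun e => F (f e) (g e)).
Proof. by move=> HF Hf Hg; exact: computable_comp HF (computable_pair Hf Hg). Qed.

Lemma computable_app3 {E A B C D} {EE : Enc E} {EA : Enc A} {EB : Enc B} {EC : Enc C}
    {ED : Enc D} (F : A -> B -> C -> D) (f : E -> A) (g : E -> B) (h : E -> C) :
  computable (fun p : A * B * C => F p.1.1 p.1.2 p.2) ->
  computable f -> computable g -> computable h ->
  computable (fun e => F (f e) (g e) (h e)).
Proof.
by move=> HF Hf Hg Hh; exact: computable_comp HF (computable_pair (computable_pair Hf Hg) Hh).
Qed.

(* [comp] proves [computable (fun e => t)] by recursion on [t], dispatching on
   the head symbol; the hooks receive further symbols as their computability
   gets proved. *)
Ltac comp_fold := fail.
Ltac comp_list := fail.
Ltac comp_nth := fail.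
Ltac comp_machine := fail.
Ltac comp1 := cbn beta; match goal with
  | |- computable (fun _ => ?c) => apply computable_cst
  | |- computable (fun x => x) => apply computable_id
  | H : computable _ |- _ => exact H
  | |- computable (fun _ => (_, _)) => eapply computable_pair
  | |- computable (fun _ => fst _) => eapply computable_fst
  | |- computable (fun _ => snd _) => eapply computable_snd
  | |- computable (fun _ => Some _) => eapply computable_Some
  | |- computable (fun _ => _ :: _) => eapply computable_cons
  | |- computable (fun _ => ohead _) => eapply computable_ohead
  | |- computable (fun _ => behead _) => eapply computable_behead
  | |- computable (fun _ => oapp _ _ _) => eapply computable_oapp
  | |- computable (fun _ => iter _ _ _) => eapply computable_iter
  | |- computable (fun _ => succn _) => eapply computable_succ
  | |- computable (fun _ => predn _) => eapply computable_pred
  | |- computable (fun _ => addn _ _) => eapply computable_addn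
  | |- computable (fun _ => subn _ _) => eapply computable_subn
  | |- computable (fun _ => muln _ _) => eapply computable_muln
  | |- computable (fun _ => leq _ _) => eapply computable_leq
  | |- computable (fun _ => negb _) => eapply computable_negb
  | |- computable (fun _ => andb _ _) => eapply computable_andb
  | |- computable (fun _ => orb _ _) => eapply computable_orb
  | |- computable (fun _ => _ == _) => eapply computable_eq
  | |- computable (fun _ => enc _) => eapply computable_enc
  | |- computable (fun _ => if _ then _ else _) => eapply computable_if
  | H : computable (fun p => ?F (fst p) (snd p)) |- computable (fun _ => ?F _ _) =>
      eapply (computable_app2 H)
  | H : computable (fun p => ?F (fst (fst p)) (snd (fst p)) (snd p))
      |- computable (fun _ => ?F _ _ _) => eapply (computable_app3 H)
  | H : computable ?F |- computable (fun _ => ?F _) => eapply (computable_comp H)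
  | |- @computable ?A _ _ _ ?f =>
      lazymatch f with (fun _ => _) => fail | _ => change (computable (fun x : A => f x)) end
  | |- _ => first [comp_fold | comp_list | comp_nth | comp_machine]
  end.
Ltac comp := repeat comp1.

Section Lists.
Context {E A B : Type} {EE : Enc E} {EA : Enc A} {EB : Enc B}.

Lemma size_seq_enc (s : seq A) : size s <= enc s.
Proof.
rewrite /enc /=; elim: s => //= a s; rewrite ltnS /npair.
by move: (seq_enc s) (enc a) (size s) => x y z; nia.
Qed.

Lemma computable_foldl (F : E -> B -> A -> B) (x : E -> B) (s : E -> seq A) :
  computable (fun p : E * B * A => F p.1.1 p.1.2 p.2) -> computable x -> computable s ->
  computable (fun e => foldl (F e) (x e) (s e)).
Proof.
move=> HF Hx Hs.
(* The code of a list bounds its length, so it serves as fuel for the loop. *)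
pose step e (w : B * seq A) := oapp (fun a => (F e w.1 a, behead w.2)) w (ohead w.2).
apply: (@computable_ext _ _ _ _ (fun e => (iter (enc (s e)) (step e) (x e, s e)).1)).
  move=> e; have := size_seq_enc (s e); move: (x e) (s e) (enc (s e)) => y t n.
  elim: n y t => [|n IHn] y [|a t] // le_tn.
    by have -> k : iter k (step e) (y, [::]) = (y, [::]) by elim: k => //= k ->.
  by rewrite iterSr IHn.
by rewrite /step; comp.
Qed.

End Lists.

Section MoreLists.
Context {E A B C : Type} {EE : Enc E} {EA : Enc A} {EB : Enc B} {EC : Enc C}.

Lemma computable_rev (s : E -> seq A) : computable s -> computable (fun e => rev (s e)).
Proof.
move=> Hs; apply: (@computable_ext _ _ _ _ (fun e => foldl (fun acc a => a :: acc) [::] (s e))).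
  by move=> e; rewrite /rev; elim: (s e) [::] => //=.
by apply: computable_foldl; comp.
Qed.

Lemma computable_foldr (F : E -> A -> B -> B) (x : E -> B) (s : E -> seq A) :
  computable (fun p : E * A * B => F p.1.1 p.1.2 p.2) -> computable x -> computable s ->
  computable (fun e => foldr (F e) (x e) (s e)).
Proof.
move=> HF Hx /computable_rev Hs.
apply: (@computable_ext _ _ _ _ (fun e => foldl (fun b a => F e a b) (x e) (rev (s e)))).
  by move=> e; rewrite foldl_rev.
by apply: computable_foldl => //; comp.
Qed.
End MoreLists.

Ltac comp_fold ::= match goal with
  | |- computable (fun _ => foldl _ _ _) => eapply computable_foldl
  | |- computable (fun _ => foldr _ _ _) => eapply computable_foldr
  | |- computable (fun _ => rev _) => eapply computable_rev
  end.

Section Seq.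
Context {E A B C : Type} {EE : Enc E} {EA : Enc A} {EB : Enc B} {EC : Enc C}.

Lemma computable_map (f : E -> A -> B) (s : E -> seq A) :
  computable (fun p : E * A => f p.1 p.2) -> computable s ->
  computable (fun e => map (f e) (s e)).
Proof.
move=> Hf Hs; apply: (@computable_ext _ _ _ _
  (fun e => foldr (fun a t => f e a :: t) [::] (s e))) => //.
by comp.
Qed.

Lemma computable_filter (f : E -> A -> bool) (s : E -> seq A) :
  computable (fun p : E * A => f p.1 p.2) -> computable s ->
  computable (fun e => [seq a <- s e | f e a]).
Proof.
move=> Hf Hs; apply: (@computable_ext _ _ _ _
  (fun e => foldr (fun a t => if f e a then a :: t else t) [::] (s e))) => //.
by comp.
Qed.

Lemma computable_all (f : E -> A -> bool) (s : E -> seq A) :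
  computable (fun p : E * A => f p.1 p.2) -> computable s ->
  computable (fun e => all (f e) (s e)).
Proof.
move=> Hf Hs; apply: (@computable_ext _ _ _ _
  (fun e => foldr (fun a t => f e a && t) true (s e))) => //.
by comp.
Qed.

Lemma computable_has (f : E -> A -> bool) (s : E -> seq A) :
  computable (fun p : E * A => f p.1 p.2) -> computable s ->
  computable (fun e => has (f e) (s e)).
Proof.
move=> Hf Hs; apply: (@computable_ext _ _ _ _
  (fun e => foldr (fun a t => f e a || t) false (s e))) => //.
by comp.
Qed.

Lemma computable_find (f : E -> A -> bool) (s : E -> seq A) :
  computable (fun p : E * A => f p.1 p.2) -> computable s ->
  computable (fun e => find (f e) (s e)).
Proof.
move=> Hf Hs; apply: (@computable_ext _ _ _ _
  (fun e => foldr (fun a n => if f e a then 0 else n.+1) 0 (s e))) => //.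
by comp.
Qed.

Lemma computable_size (s : E -> seq A) : computable s -> computable (fun e => size (s e)).
Proof.
move=> Hs; apply: (@computable_ext _ _ _ _ (fun e => foldr (fun _ n => n.+1) 0 (s e))) => //.
by comp.
Qed.

Lemma computable_cat (s t : E -> seq A) :
  computable s -> computable t -> computable (fun e => s e ++ t e).
Proof.
move=> Hs Ht; apply: (@computable_ext _ _ _ _ (fun e => foldr cons (t e) (s e))).
  by move=> e; elim: (s e) => //= a u ->.
by comp.
Qed.

Lemma computable_rcons (s : E -> seq A) (f : E -> A) :
  computable s -> computable f -> computable (fun e => rcons (s e) (f e)).
Proof.
move=> Hs Hf; apply: (@computable_ext _ _ _ _ (fun e => foldr cons [:: f e] (s e))).
  by move=> e; elim: (s e) => //= a u ->.
by comp.
Qed.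

Lemma computable_drop (n : E -> nat) (s : E -> seq A) :
  computable n -> computable s -> computable (fun e => drop (n e) (s e)).
Proof.
move=> Hn Hs; apply: (@computable_ext _ _ _ _ (fun e => iter (n e) behead (s e))).
  by move=> e; elim: (n e) (s e) => [|k IHk] [|a t] //; rewrite iterSr /= IHk //= drop0.
by comp.
Qed.

Lemma computable_omap (f : E -> A -> B) (o : E -> option A) :
  computable (fun p : E * A => f p.1 p.2) -> computable o ->
  computable (fun e => omap (f e) (o e)).
Proof.
move=> Hf Ho; apply: (@computable_ext _ _ _ _
  (fun e => oapp (fun a => Some (f e a)) None (o e))); first by move=> e; case: (o e).
by comp.
Qed.

Lemma computable_obind (f : E -> A -> option B) (o : E -> option A) :
  computable (fun p : E * A => f p.1 p.2) -> computable o ->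
  computable (fun e => obind (f e) (o e)).
Proof.
move=> Hf Ho; apply: (@computable_ext _ _ _ _ (fun e => oapp (f e) None (o e))).
  by move=> e; case: (o e).
by comp.
Qed.

Lemma computable_odflt (a : E -> A) (o : E -> option A) :
  computable a -> computable o -> computable (fun e => odflt (a e) (o e)).
Proof.
move=> Ha Ho; apply: (@computable_ext _ _ _ _ (fun e => oapp (fun a => a) (a e) (o e))).
  by move=> e; case: (o e).
by comp.
Qed.

Lemma computable_isSome (o : E -> option A) :
  computable o -> computable (fun e => isSome (o e)).
Proof.
move=> Ho; apply: (@computable_ext _ _ _ _ (fun e => oapp (fun=> true) false (o e))).
  by move=> e; case: (o e).
by comp.
Qed.

Lemma computable_iota (m n : E -> nat) :
  computable m -> computable n -> computable (fun e => iota (m e) (n e)).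
Proof.
move=> Hm Hn; apply: (@computable_ext _ _ _ _ (fun e =>
  rev (iter (n e) (fun w => (w.1.+1, w.1 :: w.2)) (m e, [::])).2)).
  move=> e; set st := fun w => _.
  suff -> : iter (n e) st (m e, [::]) = (m e + n e, rev (iota (m e) (n e))) by rewrite revK.
  elim: (n e) => [|k IHk]; first by rewrite addn0.
  have -> : iota (m e) k.+1 = rcons (iota (m e) k) (m e + k).
    by rewrite -cats1 -addn1 iotaD.
  by rewrite iterS IHk /st rev_rcons addnS.
by comp.
Qed.

Lemma computable_expn (m n : E -> nat) :
  computable m -> computable n -> computable (fun e => m e ^ n e).
Proof.
move=> Hm Hn; apply: (@computable_ext _ _ _ _ (fun e => iter (n e) (muln (m e)) 1)).
  by move=> e; elim: (n e) => //= k ->; rewrite expnS.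
by comp.
Qed.

End Seq.

Ltac comp_list ::= match goal with
  | |- computable (fun _ => map _ _) => eapply computable_map
  | |- computable (fun _ => seq.filter _ _) => eapply computable_filter
  | |- computable (fun _ => all _ _) => eapply computable_all
  | |- computable (fun _ => has _ _) => eapply computable_has
  | |- computable (fun _ => find _ _) => eapply computable_find
  | |- computable (fun _ => size _) => eapply computable_size
  | |- computable (fun _ => _ ++ _) => eapply computable_cat
  | |- computable (fun _ => rcons _ _) => eapply computable_rcons
  | |- computable (fun _ => drop _ _) => eapply computable_drop
  | |- computable (fun _ => omap _ _) => eapply computable_omap
  | |- computable (fun _ => obind _ _) => eapply computable_obind
  | |- computable (fun _ => odflt _ _) => eapply computable_odflt
  | |- computable (fun _ => isSome _) => eapply computable_isSome
  | |- computable (fun _ => iota _ _) => eapply computable_iota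
  | |- computable (fun _ => expn _ _) => eapply computable_expn
  end.

Section Seq2.
Context {E A B C : Type} {EE : Enc E} {EA : Enc A} {EB : Enc B} {EC : Enc C}.

Lemma computable_take (n : E -> nat) (s : E -> seq A) :
  computable n -> computable s -> computable (fun e => take (n e) (s e)).
Proof.
move=> Hn Hs; apply: (@computable_ext _ _ _ _
  (fun e => rev (drop (size (s e) - n e) (rev (s e))))); last by comp.
move=> e; rewrite drop_rev revK; case: (leqP (n e) (size (s e))) => [le_n|lt_n].
  by rewrite subKn.
by rewrite !take_oversize //; lia.
Qed.

Lemma computable_nth (x0 : E -> A) (s : E -> seq A) (n : E -> nat) :
  computable x0 -> computable s -> computable n ->
  computable (fun e => nth (x0 e) (s e) (n e)).
Proof.
move=> Hx Hs Hn; apply: (@computable_ext _ _ _ _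
  (fun e => odflt (x0 e) (ohead (drop (n e) (s e))))); last by comp.
by move=> e; rewrite -[in RHS](addn0 (n e)) -nth_drop; case: (drop _ _).
Qed.

Lemma computable_head (x0 : E -> A) (s : E -> seq A) :
  computable x0 -> computable s -> computable (fun e => head (x0 e) (s e)).
Proof.
move=> Hx Hs; apply: (@computable_ext _ _ _ _ (fun e => odflt (x0 e) (ohead (s e)))).
  by move=> e; case: (s e).
by comp.
Qed.

Lemma computable_flatten (s : E -> seq (seq A)) :
  computable s -> computable (fun e => flatten (s e)).
Proof. by move=> Hs; rewrite /flatten; comp. Qed.

Lemma computable_sumn (s : E -> seq nat) : computable s -> computable (fun e => sumn (s e)).
Proof. by move=> Hs; rewrite /sumn; comp. Qed.

End Seq2.

Lemma computable_mem {E} {A : eqType} {EE : Enc E} {EA : Enc A}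
    (a : E -> A) (s : E -> seq A) :
  computable a -> computable s -> computable (fun e => a e \in s e).
Proof.
move=> Ha Hs; apply: (@computable_ext _ _ _ _ (fun e => has (fun b => b == a e) (s e))).
  by move=> e; rewrite -has_pred1.
by comp.
Qed.

Lemma computable_index {E} {A : eqType} {EE : Enc E} {EA : Enc A}
    (a : E -> A) (s : E -> seq A) :
  computable a -> computable s -> computable (fun e => index (a e) (s e)).
Proof.
move=> Ha Hs; apply: (@computable_ext _ _ _ _ (fun e => find (fun b => b == a e) (s e))) => //.
by comp.
Qed.

(** The code searches a table of the values of [f]. *)
Lemma computable_finite B (A : finType) {EA : Enc A} {EB : Enc B} (f : A -> B) :
  computable f.
Proof.
(* The value at [a0] is a default that the search never reaches. *)
case: (pickP (@predT A)) => [a0 _|A0]; last first.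
  by exists id; [exact: total_recursive_id|move=> x; have := A0 x].
have H s : @computable _ _ EA EB
    (foldr (fun y g x => if x == y then f y else g x) (fun=> f a0) s).
  elim: s => [|y s IHs] /=; first exact: computable_cst.
  apply: computable_if IHs; last exact: computable_cst.
  by apply: (computable_eq (EA := EA)); [exact: computable_id|exact: computable_cst].
apply: computable_ext (H (enum A)) => x.
elim: (enum A) (mem_enum A x) => //= y s IHs.
by rewrite inE; case: eqP => [->|_].
Qed.

Ltac comp_nth ::= match goal with
  | |- computable (fun _ => take _ _) => eapply computable_take
  | |- computable (fun _ => nth _ _ _) => eapply computable_nth
  | |- computable (fun _ => head _ _) => eapply computable_head
  | |- computable (fun _ => flatten _) => eapply computable_flatten
  | |- computable (fun _ => sumn _) => eapply computable_sumn
  | |- computable (fun _ => in_mem _ _) => eapply computable_mem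
  | |- computable (fun _ => index _ _) => eapply computable_index
  end.

(** * Stages of a partial recursive function *)

Lemma computable_seq_cst I E A {EE : Enc E} {EA : Enc A} (F : I -> E -> A) (l : seq I) :
  (forall i, computable (F i)) -> computable (fun e => [seq F i e | i <- l]).
Proof.
move=> HF; elim: l => [|i l IHl] /=; first exact: computable_cst.
by apply: computable_cons.
Qed.

(** Induction on schemes: a scheme run with a bound [s] on all searches is total,
    and its values persist as [s] grows.  Composition and recursion propagate
    the lack of a value; a search for the least zero bounded by [s] stops at the
    first argument that is not known to have a positive value. *)
Lemma stage_recfun n (e : recfun n) : exists st : seq nat -> nat -> option nat,
  [/\ computable (fun p => st p.1 p.2),
      forall xs s s' y, s <= s' -> st xs s = Some y -> st xs s' = Some y
    & forall (xs : n.-tuple nat) y, receval e xs y <-> exists s, st xs s = Some y].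
Proof.
elim: e => {n} [n||n i|n k h [sth [Ch Mh Eh]] gs IHgs
  |n g [stg [Cg Mg Eg]] h [sth [Ch Mh Eh]]|n g [stg [Cg Mg Eg]]].
- exists (fun _ _ => Some 0); split=> //; first exact: computable_cst.
  by move=> xs y /=; split=> [->|[_ [<-]]]//; exists 0.
- exists (fun xs _ => Some (head 0 xs).+1); split=> //; first by comp.
  case/tupleP=> x xs y /=; rewrite theadE; split=> [->|[_ [<-]]]//; by exists 0.
- exists (fun xs _ => Some (nth 0 xs i)); split=> //; first by comp.
  by move=> xs y /=; rewrite (tnth_nth 0); split=> [->|[_ [<-]]]//; exists 0.
- have {IHgs} [stg Hg] := choice IHgs.
  pose l xs s := [seq stg i xs s | i <- enum 'I_k].
  exists (fun xs s => if all isSome (l xs s) then sth (map (odflt 0) (l xs s)) s else None).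
  split.
  + have Cl : computable (fun p => l p.1 p.2).
      by apply: (computable_seq_cst (F := fun i p => stg i p.1 p.2)) => i; case: (Hg i).
    by comp.
  + move=> xs s s' y le_s; case: ifP => // /allP alls /(Mh _ _ _ _ le_s) E.
    have -> : l xs s' = l xs s; last by move/allP: alls => ->.
    apply: eq_map => i; have [_ Mi _] := Hg i.
    have /alls := map_f (fun i => stg i xs s) (mem_enum 'I_k i).
    by case Es : (stg i xs s) => [z|//] _; exact: Mi Es.
  move=> xs y /=; split.
  + case=> zs Hzs /Eh [sh Esh].
    have /choice [si Hsi] i : exists s, stg i xs s = Some (tnth zs i).
      by have [_ _ Ei] := Hg i; apply/Ei.
    exists (maxn sh (\max_i si i)).
    have -> : l xs (maxn sh (\max_i si i)) = map Some zs.
      rewrite -[in RHS](map_tnth_enum zs) -map_comp; apply: eq_map => i /=.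
      have [_ Mi _] := Hg i; apply: Mi (Hsi i).
      by rewrite leq_max [X in _ || X]leq_bigmax orbT.
    rewrite all_map /= all_predT -map_comp map_id.
    by apply: Mh Esh; rewrite leq_maxl.
  + case=> s; case: ifP => // /allP alls E.
    have Ezs : val [tuple odflt 0 (stg i xs s) | i < k] = map (odflt 0) (l xs s).
      by rewrite -[LHS]map_tnth_enum /l -map_comp; apply: eq_map => i; rewrite tnth_mktuple.
    exists [tuple odflt 0 (stg i xs s) | i < k]; last by apply/Eh; exists s; rewrite Ezs.
    move=> i; rewrite tnth_mktuple; have [_ _ Ei] := Hg i; apply/Ei; exists s.
    have /alls := map_f (fun i => stg i xs s) (mem_enum 'I_k i).
    by case: (stg i xs s).
- pose R xs s := fix R m := if m is m'.+1 then
      obind (fun z => sth (m' :: z :: behead xs) s) (R m') else stg (behead xs) s.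
  exists (fun xs s => R xs s (head 0 xs)); split.
  + apply: (@computable_ext _ _ _ _ (fun p => (iter (head 0 p.1)
      (fun w => (w.1.+1, obind (fun z => sth (w.1 :: z :: behead p.1) p.2) w.2))
      (0, stg (behead p.1) p.2)).2)); last by comp.
    move=> [xs s] /=; set it := iter _ _ _.
    suff -> : it = (head 0 xs, R xs s (head 0 xs)) by [].
    by rewrite /it; elim: (head 0 xs) => //= m ->.
  + move=> xs s s' y le_s; elim: (head 0 xs) y => [|m IHm] y /=; first exact: Mg.
    by case Em : (R xs s m) => [z|//] /= /(Mh _ _ _ _ le_s) E; rewrite (IHm _ Em).
  (* Only the parameters matter in [xs], so its head can be fixed while the
     induction varies the recursion argument. *)
  case/tupleP=> x xs y; pose T : n.-tuple nat := [tuple of behead [tuple of x :: xs]].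
  suff : (fix prec (m y : nat) : Prop := match m with
      | 0 => receval g (T : n.-tuple nat) y
      | m'.+1 => exists2 z, prec m' z & receval h [tuple of m' :: z :: (T : n.-tuple nat)] y
      end) x y <-> exists s, R (0 :: T) s x = Some y by [].
  move: (T : n.-tuple nat) => {xs T} xs.
  have MR m s s' z : s <= s' -> R (0 :: xs) s m = Some z -> R (0 :: xs) s' m = Some z.
    move=> le_s; elim: m z => [|m IHm] z /=; first exact: Mg.
    by case Em : (R _ s m) => [w|//] /= /(Mh _ _ _ _ le_s) E; rewrite (IHm _ Em).
  elim: x y => [|m IHm] y; first exact: Eg.
  split.
  + case=> z /IHm [s Es] /Eh [s' Es']; exists (maxn s s').
    rewrite /= (MR _ _ _ _ (leq_maxl s s') Es) /=.
    exact: Mh (leq_maxr s s') Es'.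
  + case=> s /=; case Em : (R _ s m) => [z|//] /= Es.
    by exists z; [apply/IHm; exists s|apply/Eh; exists s].
- pose pos o := oapp (fun w => 0 < w) false o.
  pose y0 xs s := find (fun y => ~~ pos (stg (y :: xs) s)) (iota 0 s).
  exists (fun xs s => if stg (y0 xs s :: xs) s == Some 0 then Some (y0 xs s) else None).
  have st_fwd xs s y :
      (if stg (y0 xs s :: xs) s == Some 0 then Some (y0 xs s) else None) = Some y ->
      [/\ stg (y :: xs) s = Some 0, forall z, z < y -> pos (stg (z :: xs) s) & y <= s].
    have le_y0 : y0 xs s <= s by rewrite -[leqRHS](size_iota 0) find_size.
    case: eqP => // E0 [<-]; split=> // z lt_z.
    have lt_zs : z < s by apply: leq_trans lt_z le_y0.
    by have := before_find 0 lt_z; rewrite nth_iota // => /negbFE.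
  have st_bwd xs s y : stg (y :: xs) s = Some 0 -> (forall z, z < y -> pos (stg (z :: xs) s)) ->
      y <= s ->
      (if stg (y0 xs s :: xs) s == Some 0 then Some (y0 xs s) else None) = Some y.
    move=> E0 Epos le_y; suff -> : y0 xs s = y by rewrite E0.
    rewrite /y0 -(subnKC le_y) iotaD find_cat.
    case: hasP => [[z]|_]; first by rewrite mem_iota subnKC // => /Epos ->.
    rewrite size_iota subnKC // add0n; case: (s - y) => [|d] /=; first by rewrite addn0.
    by rewrite E0 /= addn0.
  split.
  + by rewrite /y0 /pos; comp.
  + move=> xs s s' y le_s /st_fwd [E0 Epos le_y]; apply: st_bwd (leq_trans le_y le_s).
      exact: Mg E0.
    move=> z /Epos; case Ez : (stg _ s) => [w|//]; by rewrite (Mg _ _ _ _ le_s Ez).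
  move=> xs y /=; split.
  + case=> /Eg [s0 E0] Hpos.
    have /choice [sz Hsz] z : exists s, z < y -> pos (stg (z :: xs) s).
      case: (ltnP z y) => [/Hpos [w /Eg [s Es]]|]; last by exists 0.
      by exists s => _; rewrite -/(tval [tuple of z :: xs]) /= Es.
    pose s1 := maxn (maxn s0 y) (\max_(z < y) sz z); exists s1.
    apply: st_bwd; last by rewrite /s1 -maxnA leq_max orbC leq_max leqnn.
      by apply: Mg E0; rewrite /s1 -maxnA leq_maxl.
    move=> z lt_z; have := Hsz z lt_z; case Ez : (stg _ (sz z)) => [w|//].
    rewrite (Mg _ _ _ _ _ Ez) // /s1 leq_max orbC.
    by rewrite (leq_bigmax (Ordinal lt_z)).
  + case=> s /st_fwd [E0 Epos _]; split; first by apply/Eg; exists s.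
    move=> z /Epos; case Ez : (stg _ s) => [[|w]|//] // _.
    by exists w; apply/Eg; exists s.
Qed.

(** The last bit of the string with code [m.+1] is the parity of [m], and [m./2]
    is the code of the rest. *)
Definition string_decode (m : nat) : bits :=
  (iter m (fun w => (w.1.-1./2, if w.1 == 0 then w.2 else odd w.1.-1 :: w.2)) (m, [::])).2.

Lemma string_codeK : cancel string_decode string_code.
Proof.
move=> m; rewrite /string_decode; set f := fun w => _.
(* Reading the remaining bits on top of the remaining code always gives [m]. *)
have inv k : let w := iter k f (m, [::]) in
    w.1 <= m - k /\ foldl (fun m (b : bool) => m.*2.+1 + b) w.1 w.2 = m.
  elim: k => [|k]; first by rewrite subn0.
  rewrite iterS; case: (iter k f _) => a t /= [le_a Em].
  case: a le_a Em => [|a] le_a Em //=.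
  have Ea := odd_double_half a; split; first by lia.
  by rewrite -[RHS]Em; congr foldl; lia.
have /= := inv m; case: (iter m f _) => a t /=; rewrite subnn leqn0.
by case=> /eqP -> .
Qed.

Lemma string_code_rcons x b : string_code (rcons x b) = (string_code x).*2.+1 + b.
Proof. by rewrite /string_code foldl_rcons. Qed.

Lemma string_code_inj : injective string_code.
Proof.
elim/last_ind=> [|x b IHx] y; case/lastP: y => [//|y c]; rewrite ?string_code_rcons //.
move=> E; have Exy : string_code x = string_code y by case: b c E => -[]; lia.
by rewrite (IHx _ Exy); congr rcons; case: b c E => -[]; lia.
Qed.

Lemma string_decodeK : cancel string_code string_decode.
Proof. by move=> x; apply: string_code_inj; rewrite string_codeK. Qed.

Lemma computable_nat_of_bool {E} {EE : Enc E} (b : E -> bool) :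
  computable b -> computable (fun e => nat_of_bool (b e)).
Proof. exact: computable_enc. Qed.

Lemma computable_string_code : computable string_code.
Proof.
apply: (@computable_ext _ _ _ _ (foldl (fun m (b : bool) => (m + m).+1 + nat_of_bool b) 0)).
  by move=> x; rewrite /string_code; elim: x 0 => //= b x IHx m; rewrite IHx addnn.
by comp; apply: computable_nat_of_bool; comp.
Qed.

Lemma computable_odd {E} {EE : Enc E} (f : E -> nat) :
  computable f -> computable (fun e => odd (f e)).
Proof.
move=> Hf; apply: (@computable_ext _ _ _ _ (fun e => iter (f e) (fun b => ~~ b) false)).
  by move=> e; elim: (f e) => //= n ->.
by comp.
Qed.

Lemma computable_half {E} {EE : Enc E} (f : E -> nat) :
  computable f -> computable (fun e => (f e)./2).
Proof.
move=> Hf; apply: (@computable_ext _ _ _ _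
  (fun e => (iter (f e) (fun w => (w.2, w.1.+1)) (0, 0)).1)); last by comp.
move=> e; have -> n : iter n (fun w => (w.2, w.1.+1)) (0, 0) = (n./2, uphalf n).
  by elim: n => //= n ->.
by [].
Qed.

Lemma computable_string_decode : computable string_decode.
Proof.
rewrite /string_decode; comp; first by apply: computable_half; comp.
by apply: computable_odd; comp.
Qed.

Definition stage_function (F : bits -> option bits) (st : bits -> nat -> option bits) :=
  [/\ computable (fun p => st p.1 p.2),
      forall x s s' y, s <= s' -> st x s = Some y -> st x s' = Some y
    & forall x y, F x = Some y <-> exists s, st x s = Some y].

Lemma partial_recursive_stage F : partial_recursive F -> exists st, stage_function F st.
Proof.
case=> e He; have [st [Cst Mst Est]] := stage_recfun e.
exists (fun x s => omap string_decode (st [:: string_code x] s)); split.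
- have C1 := computable_string_code; have C2 := computable_string_decode; by comp.
- move=> x s s' y le_s; case E : (st _ s) => [m|//] /= [<-].
  by rewrite (Mst _ _ _ _ le_s E).
- move=> x y; rewrite -He Est /=; split=> -[s].
    by move=> E; exists s; rewrite E /= string_decodeK.
  by case E : (st _ s) => [m|//] /= [<-]; exists s; rewrite E string_codeK.
Qed.

Lemma eventually_all (T : eqType) (l : seq T) (P : T -> nat -> Prop) :
  (forall x, x \in l -> exists t, forall t', t <= t' -> P x t') ->
  exists t, forall t', t <= t' -> forall x, x \in l -> P x t'.
Proof.
elim: l => [|a l IHl] H; first by exists 0.
have [t1 H1] := H a (mem_head _ _).
have [x lx|t2 H2] := IHl; first by apply: H; rewrite inE lx orbT.
exists (maxn t1 t2) => t'; rewrite geq_max => /andP[le1 le2] x.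
by rewrite inE => /predU1P[->|lx]; [exact: H1|exact: H2].
Qed.

Lemma stage_dom F st q s : stage_function F st -> st q s -> dom F q.
Proof.
case=> _ _ Est; case E : (st q s) => [y|//] _.
by rewrite /dom /= (Est q y).2 //; exists s.
Qed.

(** Finitely many computations that halt have all halted at some stage. *)
Lemma stage_eventually F st (l : seq bits) : stage_function F st ->
  exists t, forall s, t <= s -> forall q, q \in l -> dom F q -> st q s.
Proof.
case=> _ Mst Est; apply: eventually_all => q _; rewrite /dom /=.
case E : (F q) => [y|]; last by exists 0.
by have [t Et] := (Est q y).1 E; exists t => s /Mst /(_ Et) ->.
Qed.

(** A total function that returns 0 until an answer [y] is found, and then
    [y.+1], is turned into the partial function that returns the answer. *)
Lemma recursive2_search H : recursive2 H -> exists e : recfun 1, forall m y,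
  receval e [tuple m] y <-> exists2 s, H s m = y.+1 & forall z, z < s -> H z m = 0.
Proof.
move=> HH; have [eG HG] : recursive2 (fun s m => 1 - H s m).
  exact: (recursive2_comp recursive2_sub
    (recursive1_comp (total_recursive_cst 1) (recursive_proj ord0)) HH).
have [eP HP] : recursive2 (fun s m => (H s m).-1).
  exact: (recursive1_comp total_recursive_pred HH).
exists (Comp eP (fun i : 'I_2 => if i == ord0 then Mu eG else Proj ord0)) => m y /=.
split.
- case=> zs Hzs /HP; move: (Hzs ord0) (Hzs ord_max) => /= {Hzs}.
  rewrite [tnth [tuple m] _](tnth_nth 0) /= => -[] /HG H0 Hlt ->.
  move: (tnth zs ord0) H0 Hlt => s; rewrite !(tnth_nth 0) /= => H0 Hlt <-.
  exists s; first by rewrite prednK // lt0n; apply/eqP => E; rewrite E in H0.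
  move=> z /Hlt [w /HG]; rewrite !(tnth_nth 0) /=.
  by case: (H z m).
- case=> s Hs Hz; exists [tuple s; m]; last by apply/HP; rewrite !(tnth_nth 0) /= Hs.
  move=> i; rewrite (tnth_nth 0); case: eqP => [->|ne0] /=.
    split; first by apply/HG; rewrite !(tnth_nth 0) /= Hs.
    by move=> z /Hz Ez; exists 0; apply/HG; rewrite !(tnth_nth 0) /= Ez.
  rewrite [RHS](tnth_nth 0); case: i ne0 => [[|[|i]] lt_i] ne0 //=.
  by case: ne0; apply: val_inj.
Qed.

Definition search (h : bits -> nat -> option bits) (x : bits) : option bits :=
  if pselect (exists s, isSome (h x s)) is left E then h x (ex_minn E) else None.

Lemma searchP h x y : search h x = Some y <->
  exists2 s, h x s = Some y & forall z, z < s -> h x z = None.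
Proof.
rewrite /search; case: pselect => [E|E]; last first.
  by split=> // -[s Es]; case: E; exists s; rewrite Es.
case: ex_minnP => s hs smin; split.
  move=> Ey; exists s => // z; apply: contraTeq => nz.
  by rewrite -leqNgt; apply: smin; case: (h x z) nz.
case=> s' Es' min'; have [lt_s|lt_s|->//] := ltngtP s s'.
  by rewrite (min' _ lt_s) in hs.
by have := smin s'; rewrite Es' leqNgt lt_s => /(_ isT).
Qed.

Lemma partial_recursive_search h :
  computable (fun p => h p.1 p.2) -> partial_recursive (search h).
Proof.
move=> Ch.
pose g (p : nat * nat) := oapp (fun y => (string_code y).+1) 0 (h (string_decode p.2) p.1).
have [phi Hphi Eg] : computable g.
  have C1 := computable_string_code; have C2 := computable_string_decode.
  by rewrite /g; comp.
have HH : recursive2 (fun s m => phi (npair s m)).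
  exact: (recursive1_comp Hphi recursive2_npair).
have [e He] := recursive2_search HH; exists e => x y.
have Ephi s : phi (npair s (string_code x)) = oapp (fun y => (string_code y).+1) 0 (h x s).
  by rewrite (Eg (s, _)) /g /= string_decodeK.
rewrite He searchP; split=> -[s Es min]; exists s.
- by move: Es; rewrite Ephi; case: (h x s) => [z|//] /= [/string_code_inj ->].
- by move=> z /min; rewrite Ephi; case: (h x z).
- by rewrite Ephi Es.
- by move=> z /min; rewrite Ephi => ->.
Qed.

(** * Oracle machines with finite oracles *)

Section Machines.
Variable M : oracle_tm.

Definition config_tuple (c : config M) :=
  (cur_state c, cells_left c, cells_right c, query_tape c).

#[local] Instance enc_symbol : Enc (symbol M) := @enc_fin (option (bool + aux M)).
#[local] Instance enc_state : Enc (state M) := @enc_fin (state M).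

Lemma enc_config_inj : injective (fun c => enc (config_tuple c)).
Proof. by move=> [q l r u] [q' l' r' u'] E; case: (enc_inj E) => -> -> -> ->. Qed.
#[local] Instance enc_config : Enc (config M) := {| enc := _; enc_inj := enc_config_inj |}.

Section Fields.
Context {E : Type} {EE : Enc E}.

Lemma computable_Config (q : E -> state M) (l r : E -> seq (symbol M)) (u : E -> bits) :
  computable q -> computable l -> computable r -> computable u ->
  computable (fun e => Config (q e) (l e) (r e) (u e)).
Proof.
move=> Hq Hl Hr Hu.
have [phi Hphi H] : computable (fun e => (q e, l e, r e, u e)) by comp.
by exists phi.
Qed.

Lemma computable_config_tuple (c : E -> config M) :
  computable c -> computable (fun e => config_tuple (c e)).
Proof. by case=> phi Hphi H; exists phi. Qed.

Lemma computable_cur_state (c : E -> config M) :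
  computable c -> computable (fun e => cur_state (c e)).
Proof.
move=> /computable_config_tuple Hc.
exact: (computable_fst (computable_fst (computable_fst Hc))).
Qed.

Lemma computable_cells_left (c : E -> config M) :
  computable c -> computable (fun e => cells_left (c e)).
Proof.
move=> /computable_config_tuple Hc.
exact: (computable_snd (computable_fst (computable_fst Hc))).
Qed.

Lemma computable_cells_right (c : E -> config M) :
  computable c -> computable (fun e => cells_right (c e)).
Proof.
move=> /computable_config_tuple Hc; exact: (computable_snd (computable_fst Hc)).
Qed.

Lemma computable_query_tape (c : E -> config M) :
  computable c -> computable (fun e => query_tape (c e)).
Proof.
move=> /computable_config_tuple Hc; exact: (computable_snd Hc).
Qed.
End Fields.

Ltac comp_machine ::= match goal with
  | |- computable (fun _ => Config _ _ _ _) => eapply computable_Config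
  | |- computable (fun _ => cur_state _) => eapply computable_cur_state
  | |- computable (fun _ => cells_left _) => eapply computable_cells_left
  | |- computable (fun _ => cells_right _) => eapply computable_cells_right
  | |- computable (fun _ => query_tape _) => eapply computable_query_tape
  end.

(** [step] branches on an instruction; its branches are made total functions on
    finite types, with arbitrary values where they do not apply. *)
Definition kind (q : state M) : nat :=
  match instr q with Halt _ => 0 | Query _ _ => 1 | Act _ => 2 end.
Definition verdict_state (q : state M) : option bool :=
  if instr q is Halt b then Some b else None.
Definition answer_state (w : state M * bool) : state M :=
  if instr w.1 is Query yes no then (if w.2 then yes else no) else w.1.
Definition act (w : state M * symbol M) : state M * symbol M * direction * option bool :=
  if instr w.1 is Act delta then delta w.2 else (w.1, w.2, Stay, None).
Definition act_state w := (act w).1.1.1.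
Definition act_symbol w := (act w).1.1.2.
Definition act_bit w := (act w).2.
Definition act_move w : nat := match (act w).1.2 with Left => 0 | Stay => 1 | Right => 2 end.

Lemma computable_act {B} {EB : Enc B} (f : state M * symbol M -> B) : computable f.
Proof.
exact: (@computable_finite _ (state M * option (bool + aux M))%type).
Qed.

Lemma computable_step :
  computable (fun p : seq bits * config M => step (fun u => u \in p.1) p.2).
Proof.
pose tr (D : seq bits) (c : config M) :=
  let q := cur_state c in let l := cells_left c in
  let r := cells_right c in let u := query_tape c in
  let w := (q, head (None : symbol M) r) in
  let u' := oapp (rcons u) u (act_bit w) in
  if kind q == 0 then c else
  if kind q == 1 then Config (answer_state (q, u \in D)) l r [::] else
  if act_move w == 0 then
    Config (act_state w) (behead l)
      (head (None : symbol M) l :: act_symbol w :: behead r) u' else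
  if act_move w == 1 then Config (act_state w) l (act_symbol w :: behead r) u'
  else Config (act_state w) (act_symbol w :: l) (behead r) u'.
apply: (@computable_ext _ _ _ _ (fun p => tr p.1 p.2)).
  move=> [D [q l r u]].
  rewrite /tr /step /kind /answer_state /act_move /act_state /act_symbol /act_bit /act /=.
  case: (instr q) => [b|yes no|delta] //=; first by rewrite asboolb.
  by case: (delta _) => [[[q' s] []] [b|]].
have Ckind : computable kind by exact: computable_finite.
have Cans : computable answer_state by exact: computable_finite.
have Cst : computable act_state by exact: computable_act.
have Csy : computable act_symbol by exact: computable_act.
have Cbit : computable act_bit by exact: computable_act.
have Cmv : computable act_move by exact: computable_act.
by rewrite /tr; cbv zeta; comp.
Qed.

Definition verdict (D : seq bits) (x : bits) (t : nat) : option bool :=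
  verdict_state (cur_state (run M (fun u => u \in D) x t)).

Lemma computable_verdict {E} {EE : Enc E} (D : E -> seq bits) (x : E -> bits) (t : E -> nat) :
  computable D -> computable x -> computable t ->
  computable (fun e => verdict (D e) (x e) (t e)).
Proof.
have Cstep := computable_step.
have Cv : computable verdict_state by exact: computable_finite.
have Cbit : computable (fun b : bool => Some (inl b) : symbol M).
  exact: computable_finite.
move=> HD Hx Ht; rewrite /verdict /run /init.
apply: (computable_comp Cv); apply: computable_cur_state.
apply: computable_iter => //.
  apply: (computable_app2 (F := fun D c => step (fun u : bits => u \in D) c)) => //.
    exact: (computable_comp HD (computable_fst computable_id)).
  exact: computable_snd computable_id.
apply: computable_Config; try exact: computable_cst.
apply: computable_map => //.
exact: (computable_comp Cbit (computable_snd computable_id)).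
Qed.

Lemma verdictP D x t b : verdict D x t = Some b <->
  instr (cur_state (run M (fun u => u \in D) x t)) = Halt b.
Proof.
rewrite /verdict /verdict_state; case: (instr _) => [c|yes no|d]; split=> //; by case=> ->.
Qed.

Lemma verdict_mono D x t t' b : t <= t' -> verdict D x t = Some b -> verdict D x t' = Some b.
Proof.
move=> le_t /verdictP Ht; apply/verdictP; rewrite -(subnK le_t) /run iterD.
move: (t' - t) => k; rewrite -/(run _ _ _ _) in Ht *.
suff -> : iter k (step (fun u => u \in D)) (run M (fun u => u \in D) x t) =
    run M (fun u => u \in D) x t by [].
elim: k => //= k ->; move: Ht; case: (run _ _ _ _) => [q l r u] /= -> //.
Qed.

(** Only the answers to the queries that are actually made matter. *)
Lemma run_agree (A B : set bits) x t :
  (forall u, queries M A x u -> (A u <-> B u)) -> run M A x t = run M B x t.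
Proof.
move=> agree; elim: t => [//|t IHt]; rewrite /run !iterS -!/(run _ _ _ _) -IHt.
have := agree (query_tape (run M A x t)).
case E : (run M A x t) => [q l r u] /=; case Eq : (instr q) => [//|yes no|//] /= Hu.
have -> // : `[< A u >] = `[< B u >].
by apply: asbool_equiv_eq; apply: Hu; exists t, yes, no; rewrite E.
Qed.

(** This is how a bound on the query size is used: the oracle [B] can be
    replaced by finitely many of its elements. *)
Lemma verdict_reduces (A B : set bits) (D : seq bits) x m :
  turing_reduces_via M A B -> (forall u, queries M B x u -> size u <= m) ->
  (forall u, size u <= m -> (B u <-> u \in D)) ->
  exists t, forall t', t <= t' -> verdict D x t' = Some `[< A x >].
Proof.
move=> red le_m agree; have [t Ht] := red x; exists t => t' le_t.
apply: verdict_mono le_t _; apply/verdictP.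
by rewrite -(@run_agree B (fun u => u \in D)) // => u /le_m /agree.
Qed.
End Machines.

(** * Binary strings, Kraft's inequality and optimality *)

Definition prepend_bit (l : seq bits) : seq bits :=
  [seq true :: x | x <- l] ++ [seq false :: x | x <- l].
Definition strings (n : nat) : seq bits := iter n prepend_bit [:: [::]].
Definition strings_upto (n : nat) : seq bits :=
  iter n (fun l => [::] :: prepend_bit l) [:: [::]].

Lemma computable_strings {E} {EE : Enc E} (n : E -> nat) :
  computable n -> computable (fun e => strings (n e)).
Proof. by move=> Hn; rewrite /strings /prepend_bit; comp. Qed.

Lemma computable_strings_upto {E} {EE : Enc E} (n : E -> nat) :
  computable n -> computable (fun e => strings_upto (n e)).
Proof. by move=> Hn; rewrite /strings_upto /prepend_bit; comp. Qed.

Lemma cons_inj T (b : T) : injective (cons b).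
Proof. by move=> x y []. Qed.

Lemma mem_prepend_bit l b x : (b :: x \in prepend_bit l) = (x \in l).
Proof.
have Hin c : (b :: x \in [seq c :: y | y <- l]) = (b == c) && (x \in l).
  case: eqP => [<-|ne] /=; first by rewrite mem_map //; exact: cons_inj.
  by apply/mapP => -[y _ [/ne]].
by rewrite mem_cat !Hin; case: b {Hin}; rewrite ?orbF.
Qed.

Lemma nil_notin_prepend_bit l : [::] \notin prepend_bit l.
Proof. by rewrite mem_cat; apply/orP => -[] /mapP[]. Qed.

Lemma uniq_prepend_bit l : uniq l -> uniq (prepend_bit l).
Proof.
move=> ul; rewrite cat_uniq !map_inj_uniq ?ul ?andbT //=; try exact: cons_inj.
by apply/hasPn => _ /mapP[x _ ->]; apply/mapP => -[].
Qed.

Lemma mem_strings n x : (x \in strings n) = (size x == n).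
Proof.
elim: n x => [|n IHn] [|b x]; rewrite /strings ?iterS -?/(strings _) //.
  by rewrite (negPf (nil_notin_prepend_bit _)).
by rewrite mem_prepend_bit IHn.
Qed.

Lemma uniq_strings n : uniq (strings n).
Proof. by elim: n => //= n; exact: uniq_prepend_bit. Qed.

Lemma size_strings n : size (strings n) = 2 ^ n.
Proof. by elim: n => //= n IHn; rewrite size_cat !size_map IHn expnS mul2n addnn. Qed.

Lemma mem_strings_upto n x : (x \in strings_upto n) = (size x <= n).
Proof.
elim: n x => [|n IHn] [|b x]; rewrite /strings_upto ?iterS -?/(strings_upto _) //.
by rewrite inE mem_prepend_bit IHn.
Qed.

Lemma uniq_strings_upto n : uniq (strings_upto n).
Proof.
by elim: n => //= n IHn; rewrite nil_notin_prepend_bit uniq_prepend_bit.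
Qed.

(** Kraft's inequality in units of [2^-n], by induction on the length: either
    [A] contains the empty string and nothing else, or it splits by the first
    bit into two prefix-free halves. *)
Lemma kraft (A : pred bits) n :
  (forall p q, A p -> A q -> prefix p q -> p = q) ->
  \sum_(p <- strings_upto n | A p) 2 ^ (n - size p) <= 2 ^ n.
Proof.
elim: n A => [|n IHn] A pfA.
  by rewrite big_cons big_nil; case: ifP.
rewrite /strings_upto iterS -/(strings_upto n) big_cons subn0.
have [A0|nA0] := ifP.
  rewrite big1_seq ?addn0 // => p /andP[Ap].
  by rewrite -(pfA _ _ A0 Ap (prefix0s _)) (negPf (nil_notin_prepend_bit _)).
rewrite big_cat !big_map /= expnS mul2n -addnn.
have sub b : \sum_(x <- strings_upto n | A (b :: x)) 2 ^ (n.+1 - (size x).+1) <= 2 ^ n.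
  under eq_bigr do rewrite subSS.
  apply: (IHn (fun x => A (b :: x))) => p q Ap Aq pq.
  by have := pfA _ _ Ap Aq; rewrite /= eqxx => /(_ pq) [].
exact: leq_add.
Qed.

(** Suppose that [ready] recognizes, from [k] and a string [tau] whose length is
    determined by [k], a stage at which all halting programs of [U] shorter than
    a bound [N] have halted.  Then a string that none of them outputs can be
    computed from 1^k 0 tau, and these descriptions form a prefix-free set; by
    optimality [N] cannot exceed their length by more than a constant. *)
Lemma no_short_certificate U st (ready : nat -> bits -> nat -> option nat) :
  optimal U -> stage_function U st ->
  computable (fun p => ready p.1.1 p.1.2 p.2) ->
  (forall k tau tau' s s', ready k tau s -> ready k tau' s' -> size tau = size tau') ->
  exists d, forall k tau s0, ready k tau s0 ->
    (forall s N, ready k tau s = Some N ->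
      forall q, size q < N -> dom U q -> st q s) ->
    exists s N, ready k tau s = Some N /\ N <= k + size tau + d.
Proof.
case=> _ optU [Cst Mst Est] Cready Hlen.
(* [fresh N s] is longer than every output found by stage [s]. *)
pose fresh N s := rcons (flatten [seq odflt [::] (st q s) | q <- strings_upto N]) true.
(* [idx] reads [k] off 1^k 0 tau. *)
pose idx (p : bits) := find negb p.
pose h p s := if has negb p
  then omap (fun N => fresh N s) (ready (idx p) (drop (idx p).+1 p) s) else None.
have Ch : computable (fun p => h p.1 p.2).
  have Cup : computable strings_upto by apply: computable_strings_upto; comp.
  by rewrite /h /fresh /idx; comp.
have pfF : prefix_free_machine (search h).
  split; first exact: partial_recursive_search.
  have domF p : dom (search h) p -> has negb p /\ exists s, ready (idx p) (drop (idx p).+1 p) s.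
    rewrite /dom /=; case E : (search h p) => [y|//] _; move/searchP: E => [s].
    rewrite /h; case: ifP => // _; case E : (ready _ _ _) => [N|//] _ _.
    by split=> //; exists s; rewrite E.
  move=> p q /domF [np [s rp]] /domF [nq [s' rq]] /prefixP [r Eq].
  have Eidx : idx q = idx p by rewrite Eq /idx find_cat np.
  have rq' := rq; rewrite [in X in ready X]Eidx in rq'.
  have := Hlen _ _ _ _ _ rp rq'.
  have lt_p : idx p < size p by rewrite -has_find.
  have -> : drop (idx q).+1 q = drop (idx p).+1 p ++ r.
    rewrite Eidx Eq drop_cat; case: ltnP => // ge_p.
    have Esize : (idx p).+1 = size p by apply/eqP; rewrite eqn_leq lt_p.
    by rewrite Esize subnn drop0 drop_size.
  by rewrite size_cat -[LHS]addn0 => /addnI /esym/size0nil r0; rewrite Eq r0 cats0.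
have [d Hd] := optU _ pfF; exists d.+1 => k tau s0 r0 cert.
pose p := nseq k true ++ false :: tau.
have hp : has negb p by rewrite has_cat /= orbT.
have Eidx : idx p = k.
  by rewrite /idx find_cat has_nseq /= andbF size_nseq addn0.
have Edrop : drop (idx p).+1 p = tau.
  by rewrite Eidx drop_cat size_nseq ltnNge leqnSn /= subSnn /= drop0.
have [y Fp] : exists y, search h p = Some y.
  case E : (search h p) => [y|]; first by exists y.
  have ex : exists s, h p s.
    by exists s0; rewrite /h hp Edrop Eidx; case: (ready k tau s0) r0.
  move: E; rewrite /search; case: pselect => [e|/(_ ex)//].
  by case: ex_minnP => s hs _ E; rewrite E in hs.
have dFp : dom (search h) p by rewrite /dom /= Fp.
have [q [dq Uq le_q]] := Hd _ dFp.
case/searchP: (Fp) => s hs _; move: hs; rewrite /h hp Edrop Eidx.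
case Er : (ready k tau s) => [N|//] [Ey]; exists s, N; split=> //.
have size_p : size p = k + (size tau).+1 by rewrite size_cat size_nseq.
suff le_N : N <= size q by apply: leq_trans le_N (leq_trans le_q _); rewrite size_p; lia.
rewrite leqNgt; apply/negP => lt_q.
have := cert _ _ Er _ lt_q dq; case Es : (st q s) => [z|//] _.
have Uqz : U q = Some z by apply/Est; exists s.
have Ezy : z = y by move: Uq; rewrite Uqz Fp => -[].
have : z \in [seq odflt [::] (st q s) | q <- strings_upto N].
  by apply/mapP; exists q; rewrite ?Es // mem_strings_upto ltnW.
move: Ey; rewrite Ezy /fresh; move: (map _ _) => l Ey.
suff Hl x : x \in l -> size x <= size (flatten l).
  by move/Hl; rewrite -Ey size_rcons ltnn.
elim: l {Ey} => //= a l IHl; rewrite inE size_cat => /orP[/eqP->|/IHl]; lia.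
Qed.

(** * Truncated binary expansions *)

Definition binval (x : bits) : nat := foldl (fun m (b : bool) => m.*2 + b) 0 x.

Lemma binval_mkseqS b n : binval (mkseq b n.+1) = (binval (mkseq b n)).*2 + b n.
Proof. by rewrite mkseqS /binval foldl_rcons. Qed.

Section BinaryExpansion.
Local Open Scope classical_set_scope.
Local Open Scope ring_scope.
Variable R : realType.
Implicit Types (b : nat -> bool) (beta : R).

(** This is equivalent to [b] being the expansion of [beta] with infinitely many
    zeros, and is easier to use: the strict upper bound rules out the expansions
    that end in ones. *)
Definition truncates b beta : Prop :=
  forall n, (binval (mkseq b n))%:R <= beta * 2 ^+ n < (binval (mkseq b n)).+1%:R.

Lemma partial_sum_binval b n :
  \sum_(0 <= i < n) (b i)%:R / 2 ^+ i.+1 = (binval (mkseq b n))%:R / 2 ^+ n :> R.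
Proof.
elim: n => [|n IHn]; first by rewrite big_geq // mul0r.
rewrite big_nat_recr //= IHn binval_mkseqS natrD -mul2n natrM exprS.
by field; rewrite expf_neq0.
Qed.

Lemma truncates_inj b b' beta : truncates b beta -> truncates b' beta -> b =1 b'.
Proof.
move=> tb tb' i.
have Ev n : binval (mkseq b n) = binval (mkseq b' n).
  by rewrite -(Num.Theory.truncn_def (tb n)) -(Num.Theory.truncn_def (tb' n)).
have := Ev i.+1; rewrite !binval_mkseqS Ev => /addnI.
by case: (b i) (b' i) => -[].
Qed.

Lemma expansion_truncates b beta :
  binary_expansion beta b -> infinitely_many_zeros b -> truncates b beta.
Proof.
move=> cvgb zeros.
pose S n : R := (binval (mkseq b n))%:R / 2 ^+ n.
(* The partial sums [S] increase to [beta]; the upper bounds [U] decrease, and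
   strictly so at each zero of [b]. *)
pose U n : R := (binval (mkseq b n)).+1%:R / 2 ^+ n.
have cvgS : S n @[n --> \oo] --> beta.
  by rewrite (_ : S = fun n => \sum_(0 <= i < n) (b i)%:R / 2 ^+ i.+1) //;
    apply/funext => n; rewrite partial_sum_binval.
have p2 n : 0 < 2 ^+ n :> R by rewrite exprn_gt0.
have SleU n : S n <= U n by rewrite ler_pM2r ?invr_gt0 // ler_nat.
have half n (a : nat) : a%:R / 2 ^+ n = (a.*2)%:R / 2 ^+ n.+1 :> R.
  by rewrite -mul2n natrM exprS; field; rewrite gt_eqF.
have SS n : S n <= S n.+1.
  by rewrite /S half ler_pM2r ?invr_gt0 // ler_nat binval_mkseqS; lia.
have US n : U n.+1 <= U n.
  by rewrite /U [leRHS]half ler_pM2r ?invr_gt0 // ler_nat binval_mkseqS; lia.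
have US0 n : b n = false -> U n.+1 < U n.
  by move=> bn; rewrite /U [ltRHS]half ltr_pM2r ?invr_gt0 // ltr_nat binval_mkseqS bn; lia.
have Smono m n : (m <= n)%N -> S m <= S n.
  by move=> /subnK <-; elim: (n - m)%N => // k IHk; rewrite addSn (le_trans IHk).
have Umono m n : (m <= n)%N -> U n <= U m.
  by move=> /subnK <-; elim: (n - m)%N => // k; rewrite addSn; apply: le_trans.
have Sbeta n : S n <= beta.
  apply: (cvgr_to_ge cvgS); near=> m; apply: Smono; near: m; exact: nbhs_infty_ge.
have betaU n : beta <= U n.
  apply: (cvgr_to_le cvgS); near=> m; apply: le_trans (SleU m) _.
  by apply: Umono; near: m; exact: nbhs_infty_ge.
move=> n; rewrite -ler_pdivrMr // Sbeta /= -ltr_pdivlMr //.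
have [i le_i bi] := zeros n.
by apply: le_lt_trans (betaU i.+1) _; apply: lt_le_trans (US0 _ bi) (Umono _ _ le_i).
Unshelve. all: by end_near.
Qed.

Lemma truncates_exists beta : 0 <= beta < 1 -> exists b, truncates b beta.
Proof.
case/andP=> ge0 lt1; pose v n := Num.truncn (beta * 2 ^+ n).
have p2 n : 0 < 2 ^+ n :> R by rewrite exprn_gt0.
have vP n : (v n)%:R <= beta * 2 ^+ n < (v n).+1%:R.
  by apply: truncn_itv; rewrite mulr_ge0 // ltW.
exists (fun n => odd (v n.+1)) => n.
suff -> : binval (mkseq (fun n => odd (v n.+1)) n) = v n by exact: vP.
elim: n => [|n IHn].
  apply/esym/truncn_def; rewrite expr0 mulr1 ge0 /=; exact: lt1.
rewrite binval_mkseqS IHn.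
have /andP[l1 u1] := vP n; have /andP[l2 u2] := vP n.+1.
have E : beta * 2 ^+ n.+1 = (beta * 2 ^+ n) * 2 by rewrite exprSr mulrA.
have H1 : ((v n).*2 < (v n.+1).+1)%N.
  rewrite -(ltr_nat R); apply: le_lt_trans u2; rewrite E -muln2 natrM.
  by rewrite ler_pM2r.
have H2 : (v n.+1 < (v n).+1.*2)%N.
  rewrite -(ltr_nat R); apply: le_lt_trans l2 _; rewrite E -muln2 natrM.
  by rewrite ltr_pM2r.
by have := odd_double_half (v n.+1); case: (odd _) => /=; lia.
Qed.

Lemma truncates_expansion b beta : truncates b beta ->
  binary_expansion beta b /\ infinitely_many_zeros b.
Proof.
move=> tb; have p2 n : 0 < 2 ^+ n :> R by rewrite exprn_gt0.
pose S n : R := (binval (mkseq b n))%:R / 2 ^+ n.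
have bound n : beta - 2^-1 ^+ n <= S n <= beta.
  have /andP[l u] := tb n; rewrite ler_pdivrMr // l andbT lerBlDr.
  rewrite exprVn /S -[X in _ + X]mul1r -mulrDl ler_pdivlMr //.
  by rewrite natr1 ltW.
have cvgS : S n @[n --> \oo] --> beta.
  apply: (@squeeze_cvgr _ _ _ _ (fun n => beta - 2^-1 ^+ n) (fun=> beta)).
  - by near=> n; exact: bound.
  - rewrite -[X in _ --> X]subr0; apply: cvgB; first exact: cvg_cst.
    by apply: cvg_expr; rewrite ger0_norm; lra.
  - exact: cvg_cst.
split.
  by rewrite /binary_expansion (_ : (fun n => _) = S) //;
    apply/funext => n; rewrite partial_sum_binval.
move=> m; apply: contrapT => nz.
have ones i : (m <= i)%N -> b i = true.
  by move=> le_i; apply/negPn/negP => /negbTE bi; apply: nz; exists i.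
(* If all bits from [m] on are ones, the upper bounds stay at their value [c] at
   [m], and the partial sums tend to [c] too, whereas [beta < c]. *)
have Econst k : (binval (mkseq b (m + k))).+1 = ((binval (mkseq b m)).+1 * 2 ^ k)%N.
  elim: k => [|k IHk]; first by rewrite addn0 muln1.
  by rewrite addnS binval_mkseqS ones ?leq_addr // expnS; lia.
have /andP[_ u] := tb m.
have : (binval (mkseq b m)).+1%:R / 2 ^+ m <= beta.
  set c := (X in X <= _).
  have cvgU : (c - 2^-1 ^+ n : R) @[n --> \oo] --> c.
    rewrite -[X in _ --> X]subr0; apply: cvgB; first exact: cvg_cst.
    by apply: cvg_expr; rewrite ger0_norm; lra.
  apply: (cvgr_to_le cvgU).
  near=> n; have le_n : (m <= n)%N by near: n; exact: nbhs_infty_ge.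
  have /andP[_] := bound n; apply: le_trans.
  rewrite /c /S -(subnKC le_n); move: (n - m)%N (Econst (n - m)%N) => k Ek.
  have -> : (binval (mkseq b (m + k)))%:R = (binval (mkseq b m)).+1%:R * 2 ^+ k - 1 :> R.
    by rewrite -natrX -natrM -Ek -natr1 addrK.
  by rewrite exprVn exprD le_eqVlt; apply/orP; left; apply/eqP; field; rewrite !gt_eqF.
by rewrite ler_pdivrMr // leNgt u.
Unshelve. all: by end_near.
Qed.

(** Existence and uniqueness of the expansion together: [Pf] is the set of
    prefixes of a single sequence. *)
Lemma Pf_spec (alpha : R) : exists2 b,
  truncates b (alpha - (Num.floor alpha)%:~R) &
  forall x, Pf alpha x <-> x = mkseq b (size x).
Proof.
set beta := alpha - _.
have /truncates_exists [b tb] : 0 <= beta < 1.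
  have := Num.Theory.floor_itv alpha; rewrite /beta.
  rewrite intrD; lra.
exists b => // x; split.
- case=> b' [/expansion_truncates exp /exp tb' [n ->]]; rewrite size_mkseq.
  by apply: eq_mkseq; exact: truncates_inj tb' tb.
- by have [exp zeros] := truncates_expansion tb => Ex; exists b; split=> //; exists (size x).
Qed.

End BinaryExpansion.

(** * The halting probability and its approximations *)

(** The unit is [2^-n], so that approximations of the halting probability are
    computed with natural numbers. *)
Definition mass (A : pred bits) (n : nat) : nat :=
  \sum_(p <- strings_upto n | A p) 2 ^ (n - size p).

Section Omega.
Local Open Scope classical_set_scope.
Local Open Scope ring_scope.
Variables (R : realType) (V : bits -> option bits).
Hypothesis pfV : prefix_free (dom V).

Lemma massE (A : pred bits) n :
  (mass A n)%:R / 2 ^+ n = \sum_(p <- strings_upto n | A p) 2^-1 ^+ size p :> R.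
Proof.
rewrite /mass natr_sum mulr_suml big_seq_cond [RHS]big_seq_cond; apply: eq_bigr => p.
rewrite mem_strings_upto => /andP[le_p _].
have p2 k : 2 ^+ k != 0 :> R by rewrite expf_neq0 // pnatr_eq0.
by rewrite natrX exprVn -[in X in _ / X](subnK le_p) exprD invfM mulrA divff // mul1r.
Qed.

Lemma mass_mono (A : pred bits) m n : (m <= n)%N ->
  (mass A m)%:R / 2 ^+ m <= (mass A n)%:R / 2 ^+ n :> R.
Proof.
move=> le_mn; rewrite !massE.
have pos (p : bits) : 0 <= 2^-1 ^+ size p :> R by rewrite exprn_ge0 // invr_ge0.
rewrite -!(big_filter _ A).
set s := [seq p <- strings_upto m | A p]; set t := [seq p <- strings_upto n | A p].
have : perm_eq [seq p <- t | p \in s] s.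
  apply: uniq_perm; rewrite ?filter_uniq ?uniq_strings_upto // => p.
  rewrite mem_filter andb_idr // !mem_filter !mem_strings_upto => /andP[-> /= le_p].
  exact: leq_trans le_p le_mn.
by move/(perm_big _) <-; rewrite big_filter [leRHS](bigID (mem s)) /= lerDl sumr_ge0.
Qed.

Let weight (p : bits) : \bar R := (2^-1 ^+ size p)%:E.

Let weight_ge0 p : (0 <= weight p)%E.
Proof. by rewrite lee_fin exprn_ge0 // invr_ge0. Qed.

Lemma finite_weight_le (F : set bits) : finite_set F -> F `<=` dom V -> exists n,
  (\sum_(p \in F) weight p <= ((mass (fun p => `[< dom V p >]) n)%:R / 2 ^+ n)%:E)%E.
Proof.
move=> /finite_fsetP[X ->] sub; pose n := (\max_(p <- X) size p)%N; exists n.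
rewrite -fsbig_seq ?fset_uniq // massE sumEFin lee_fin.
rewrite -[leRHS]big_filter; set t := [seq p <- strings_upto n | `[< dom V p >]].
have : perm_eq [seq p <- t | p \in X] X.
  apply: uniq_perm; rewrite ?filter_uniq ?uniq_strings_upto ?fset_uniq // => p.
  rewrite mem_filter andb_idr // !mem_filter mem_strings_upto => Xp.
  apply/andP; split; first by apply/asboolP; exact: sub.
  exact: (@leq_bigmax_seq _ (enum_fset X) predT (fun p : bits => size p) p Xp isT).
move/(perm_big _) <-; rewrite big_filter [leRHS](bigID (mem X)) /= lerDl sumr_ge0 // => p _.
Qed.

Lemma esum_weight_le1 : (\esum_(p in dom V) weight p <= 1)%E.
Proof.
apply: ge_ereal_sup => _ [F [finF subF] <-].
have [n le_n] := finite_weight_le finF subF; apply: le_trans le_n _.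
rewrite lee_fin ler_pdivrMr ?exprn_gt0 // mul1r -natrX ler_nat.
by apply: kraft => p q /asboolP Vp /asboolP Vq; exact: pfV.
Qed.

Lemma OmegaE : (Omega R V)%:E = (\esum_(p in dom V) weight p)%E.
Proof.
rewrite /Omega fineK // ge0_fin_numE; last by apply: esum_ge0.
exact: le_lt_trans esum_weight_le1 (ltry _).
Qed.

Lemma Omega_ge0 : 0 <= Omega R V.
Proof. by rewrite -lee_fin OmegaE esum_ge0. Qed.

Lemma mass_le_Omega (A : pred bits) n : (forall p, A p -> dom V p) ->
  (mass A n)%:R / 2 ^+ n <= Omega R V.
Proof.
move=> sub; rewrite -lee_fin OmegaE massE -big_filter.
rewrite -sumEFin fsbig_seq ?filter_uniq ?uniq_strings_upto //.
apply: ereal_sup_ubound; exists [set` [seq p <- strings_upto n | A p]] => //.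
split=> [|p /=]; first exact: finite_seq.
by rewrite mem_filter => /andP[/sub].
Qed.

Lemma Omega_lt_mass x : x < Omega R V ->
  exists n, x < (mass (fun p => `[< dom V p >]) n)%:R / 2 ^+ n.
Proof.
rewrite -lte_fin OmegaE => /ereal_sup_gt[_ [F [finF subF] <-]] lt_x.
have [n le_n] := finite_weight_le finF subF; exists n.
by rewrite -lte_fin; exact: lt_le_trans le_n.
Qed.
End Omega.

Section Settled.
Local Open Scope ring_scope.
Variables (R : realType) (V : bits -> option bits) (st : bits -> nat -> option bits).
Hypotheses (pfV : prefix_free (dom V)) (Hst : stage_function V st).

Definition stage_weight (s : nat) : nat := mass (fun q => isSome (st q s)) s.

(** If the weight of the programs halted by stage [s] is above [(k - 1) / 2^n],
    a program shorter than [n] that halts later would push the total above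
    [(k + 1) / 2^n], as its own weight is at least [2 / 2^n].  Asking the weight
    to exceed [k / 2^n] instead would not do, as it may never happen when
    [Omega] equals [k / 2^n]. *)
Lemma Omega_settles n k s : Omega R V * 2 ^+ n < k.+1%:R ->
  (k * 2 ^ s < stage_weight s * 2 ^ n + 2 ^ s)%N ->
  forall q, (size q < n)%N -> dom V q -> st q s.
Proof.
move=> Omega_lt Hk q lt_q dq; apply: contrapT => nq.
have p2 m : 0 < 2 ^+ m :> R by rewrite exprn_gt0.
pose A q' := isSome (st q' s).
have Asub p : A p || (p == q) -> dom V p.
  by case/orP => [/(stage_dom Hst)|/eqP->].
have := mass_le_Omega R pfV (maxn s (size q)) Asub.
rewrite massE big_mkcond (bigD1_seq q) ?uniq_strings_upto ?mem_strings_upto ?leq_maxr //=.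
rewrite eqxx orbT -big_mkcondr (eq_bigl A) => [|p]; last first.
  by case: eqVneq => [->|_]; rewrite ?orbF //; apply/esym/negbTE/negP.
rewrite -massE => le_Omega; set w := stage_weight s in Hk.
have le_w : w%:R / 2 ^+ s + 2^-1 ^+ size q <= Omega R V.
  apply: le_trans le_Omega.
  rewrite [leLHS]addrC lerD2l; exact: (mass_mono R A (leq_maxl s _)).
have Hk' : k%:R < w%:R / 2 ^+ s * 2 ^+ n + 1 :> R.
  rewrite -(ltr_pM2r (p2 s)) mulrDl mul1r mulrAC mulfVK ?gt_eqF //.
  by rewrite -!natrX -!natrM -natrD ltr_nat.
have two_le : 2 <= 2^-1 ^+ size q * 2 ^+ n :> R.
  rewrite -(subnKC lt_q) exprD mulrA exprVn exprS mulrCA mulVf ?gt_eqF // mulr1.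
  by rewrite ler_peMr // exprn_ege1 // ler1n.
have : (w%:R / 2 ^+ s + 2^-1 ^+ size q) * 2 ^+ n <= Omega R V * 2 ^+ n.
  by rewrite ler_pM2r.
by rewrite mulrDl; move: Omega_lt; rewrite -natr1; lra.
Qed.

Lemma Omega_approached n k : k%:R <= Omega R V * 2 ^+ n -> exists t, forall s,
  (t <= s)%N -> (k * 2 ^ s < stage_weight s * 2 ^ n + 2 ^ s)%N.
Proof.
move=> le_k; have p2 m : 0 < 2 ^+ m :> R by rewrite exprn_gt0.
have lt_k : (k%:R - 1) / 2 ^+ n < Omega R V by rewrite ltr_pdivrMr //; lra.
have [m lt_m] := Omega_lt_mass pfV lt_k.
have [t Ht] := stage_eventually (strings_upto m) Hst.
exists (maxn t m) => s; rewrite geq_max => /andP[le_t le_m].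
have Emass : mass (fun q => `[< dom V q >]) m = mass (fun q => isSome (st q s)) m.
  rewrite /mass big_seq_cond [RHS]big_seq_cond; apply: eq_bigl => q.
  case: (boolP (q \in _)) => //= uq; apply/asboolP/idP => [|/(stage_dom Hst)//].
  exact: Ht.
have lt_w : (k%:R - 1) / 2 ^+ n < (stage_weight s)%:R / 2 ^+ s :> R.
  apply: lt_le_trans lt_m _; rewrite Emass; exact: mass_mono.
rewrite -(ltr_nat R) natrD !natrM !natrX -ltrBlDr -[X in _ - X]mul1r -mulrBl.
by rewrite -ltr_pdivlMr // mulrAC -ltr_pdivrMr.
Qed.
End Settled.

(** * Queries needed to decide a domain *)

Lemma find_iota0 (a : pred nat) s : find a (iota 0 s) < s ->
  a (find a (iota 0 s)) /\ forall m, m < find a (iota 0 s) -> ~~ a m.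
Proof.
move=> lt_s; split.
  have := nth_find 0 (_ : has a (iota 0 s)); rewrite has_find size_iota => /(_ lt_s).
  by rewrite nth_iota.
move=> m lt_m; have := before_find 0 lt_m.
by rewrite nth_iota ?add0n; [move->|exact: ltn_trans lt_s].
Qed.

Lemma find_iota0E (a : pred nat) s n : a n -> (forall m, m < n -> ~~ a m) -> n < s ->
  find a (iota 0 s) = n.
Proof.
move=> an min lt_n.
have lt_s : find a (iota 0 s) < s.
  by rewrite -[X in _ < X](size_iota 0) -has_find; apply/hasP; exists n; rewrite // mem_iota.
have [af minf] := find_iota0 lt_s.
case: (ltngtP (find a (iota 0 s)) n) => // [/min|/minf]; by rewrite ?af ?an.
Qed.

Lemma mem_prefixes (b : nat -> bool) m u : size u <= m ->
  (u = mkseq b (size u) <-> u \in [seq take i (mkseq b m) | i <- iota 0 m.+1]).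
Proof.
have takeE i : i <= m -> take i (mkseq b m) = mkseq b i.
  by move=> le_i; rewrite /mkseq -map_take take_iota (minn_idPl le_i).
move=> le_u; split=> [Eu|/mapP[i]].
  by apply/mapP; exists (size u); rewrite ?mem_iota ?takeE.
by rewrite mem_iota /= ltnS => le_i ->; rewrite takeE // size_mkseq.
Qed.

(** The least [n] with [f n <= n - 2k] is computable from [k], and [f n] bits of
    the real certify which programs of length at most [n] halt: for large [k],
    this certificate is too short. *)
Lemma halting_query_size (R : realType) (alpha : R) W f :
  optimal W -> {homo f : m n / m <= n} -> total_recursive f ->
  reducible_in_query_size f (dom W) (Pf alpha) -> exists c, forall n, n <= f n + c.
Proof.
move=> optW monof recf [M [red le_f]].
have [st Hst] := partial_recursive_stage optW.1.1; have [Cst _ _] := Hst.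
have [b _ Pfb] := Pf_spec alpha.
apply: contrapT => no_c.
have small k : exists n, f n + (k + k) <= n.
  apply: contrapT => none; apply: no_c; exists (k + k) => n.
  by rewrite leqNgt; apply/negP => lt_n; apply: none; exists n; exact: ltnW.
(* [level k s] is the least [n] with [f n + 2k <= n], as soon as it is below [s].
   At a ready stage, the machine with the prefixes of [tau] as oracle has decided
   all strings up to that length, and those it accepts have halted. *)
pose prefixes (tau : bits) := [seq take i tau | i <- iota 0 (size tau).+1].
pose level k s := find (fun m => f m + (k + k) <= m) (iota 0 s).
pose ok tau s x :=
  oapp (fun a => ~~ a || isSome (st x s)) false (verdict M (prefixes tau) x s).
pose ready k tau s :=
  if [&& level k s < s, size tau == f (level k s) & all (ok tau s) (strings_upto (level k s))]
  then Some (level k s).+1 else None.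
have Cready : computable (fun p => ready p.1.1 p.1.2 p.2).
  have Cf : computable f by case: recf => e He; exists f => //; exists e.
  have Cup : computable strings_upto by apply: computable_strings_upto; comp.
  have Cv : computable (fun p => verdict M p.1.1 p.1.2 p.2).
    by apply: computable_verdict; comp.
  by rewrite /ready /level /ok /prefixes; comp.
have Elevel k s n : f n + (k + k) <= n -> (forall m, m < n -> ~~ (f m + (k + k) <= m)) ->
    level k s < s -> level k s = n.
  move=> an min /find_iota0[af minf].
  by case: (ltngtP (level k s) n) => // [/min|/minf]; rewrite ?an ?af.
have Hlen k tau tau' s s' : ready k tau s -> ready k tau' s' -> size tau = size tau'.
  rewrite /ready; case: ifP => // /and3P[lt_s /eqP -> _] _.
  case: ifP => // /and3P[lt_s' /eqP -> _] _.
  by have [af minf] := find_iota0 lt_s'; rewrite (Elevel _ _ _ af minf lt_s).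
have [d Hd] := no_short_certificate optW Hst Cready Hlen.
(* With [k = d + 1] the certificate has length [f n <= n - 2k], which is short
   enough for a contradiction. *)
have := small d.+1; case/ex_minnP => n an minn.
have min m : m < n -> ~~ (f m + (d.+1 + d.+1) <= m).
  by move=> lt_m; apply/negP => /minn; rewrite leqNgt lt_m.
pose tau := mkseq b (f n).
have agree (x u : bits) : size x <= n -> size u <= f (size x) ->
    (Pf alpha u <-> u \in prefixes tau).
  move=> le_x le_u; rewrite Pfb /prefixes size_mkseq.
  exact: mem_prefixes (leq_trans le_u (monof _ _ le_x)).
have ev x : x \in strings_upto n ->
    exists t, forall t', t <= t' -> verdict M (prefixes tau) x t' = Some `[< dom W x >].
  rewrite mem_strings_upto => le_x.
  exact: (verdict_reduces (m := f (size x)) red (le_f x) (fun u => agree x u le_x)).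
have [t1 H1] := eventually_all ev.
have [t2 H2] := stage_eventually (strings_upto n) Hst.
have Rdy s : n < s -> t1 <= s -> t2 <= s -> ready d.+1 tau s = Some n.+1.
  move=> lt_n le1 le2; have El : level d.+1 s = n by exact: find_iota0E.
  rewrite /ready El lt_n size_mkseq eqxx /=.
  case: allP => // -[] x ux; rewrite /ok H1 //=.
  by case: asboolP => //= dx; rewrite (H2 _ le2).
have [||s [N [HN le_N]]] := Hd d.+1 tau (maxn n.+1 (maxn t1 t2)).
- by rewrite Rdy // !leq_max leqnn ?orbT.
- move=> s N; rewrite /ready; case: ifP => // /and3P[lt_s _ /allP alls] [<-] q lt_q dq.
  have El := Elevel _ _ _ an min lt_s; rewrite El ltnS in lt_q.
  have uq : q \in strings_upto n by rewrite mem_strings_upto.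
  have := alls q; rewrite El uq /ok => /(_ isT).
  case Ev : (verdict _ _ _ _) => [a|//] /=.
  have := verdict_mono (leq_maxl s t1) Ev; rewrite H1 ?leq_maxr // => -[<-].
  by rewrite asboolT.
move: HN; rewrite /ready; case: ifP => // /and3P[lt_s _ _] [EN].
by move: le_N; rewrite -EN (Elevel _ _ _ an min lt_s) size_mkseq; lia.
Qed.

(** * Queries needed to find the digits of the halting probability *)

Lemma sum_pow2_lt n a : \sum_(j <- iota 1 n | a <= j) 2 ^ (n - j) < 2 ^ (n.+1 - a).
Proof.
elim: n => [|n IHn]; first by rewrite big_nil expn_gt0.
have -> : iota 1 n.+1 = iota 1 n ++ [:: n.+1] by rewrite -[n.+1]addn1 iotaD add1n addn1.
rewrite big_cat big_cons big_nil /= subnn.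
have -> : \sum_(j <- iota 1 n | a <= j) 2 ^ (n.+1 - j) =
    2 * \sum_(j <- iota 1 n | a <= j) 2 ^ (n - j).
  rewrite big_distrr /= big_seq_cond [RHS]big_seq_cond; apply: eq_bigr => j.
  by rewrite mem_iota add1n ltnS -expnS => /andP[/andP[_ le_j] _]; rewrite subSn.
case: (leqP a n.+1) => [le_a|lt_a].
  by rewrite [n.+2 - a]subSn // expnS; move: IHn; lia.
have := expn_gt0 2 (n.+2 - a); move: IHn.
by rewrite (_ : n.+1 - a = 0); lia.
Qed.

Section Guesses.
Variables (M : oracle_tm) (st : bits -> nat -> option bits) (c : nat).
Variable W : bits -> option bits.
Hypothesis optW : optimal W.
Hypothesis Hst : stage_function W st.

Definition halted (j s : nat) : seq bits := [seq q <- strings_upto (j + c) | isSome (st q s)].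

(** When the oracle is not yet complete the machine may accept several strings
    of length [j] or none.  Taking the first one, and only once all have been
    decided, makes the guess a function of the oracle alone. *)
Definition guess (j s : nat) : option bits :=
  if all (fun x => isSome (verdict M (halted j s) x s)) (strings j)
  then ohead [seq x <- strings j | verdict M (halted j s) x s == Some true] else None.

Let halting : pred bits := fun q => `[< dom W q >].

Lemma halted_sub j s s' : s <= s' -> {subset halted j s <= halted j s'}.
Proof.
move=> le_s q; rewrite !mem_filter => /andP[sq ->]; rewrite andbT.
have [_ Mst _] := Hst; case E : (st q s) sq => [y|//] _.
by rewrite (Mst _ _ _ _ le_s E).
Qed.

Lemma halted_halting j s q : q \in halted j s -> halting q.
Proof.
by rewrite mem_filter => /andP[sq _]; apply/asboolP; exact: stage_dom Hst sq.
Qed.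

Lemma guess_det j s s' x y : halted j s = halted j s' ->
  guess j s = Some x -> guess j s' = Some y -> x = y.
Proof.
wlog le_s : s s' x y / s <= s' => [H|].
  by case: (leqP s s') => [/H|/ltnW/H] H' E Ex Ey; [exact: H'|exact/esym/(H' _ _ (esym E))].
rewrite /guess => <-; case: ifP => // /allP dec Ex; case: ifP => // _ Ey.
have E : [seq x <- strings j | verdict M (halted j s) x s == Some true] =
    [seq x <- strings j | verdict M (halted j s) x s' == Some true].
  apply: eq_in_filter => z /dec; case Ez : (verdict _ _ _ s) => [b|//] _.
  by rewrite (verdict_mono le_s Ez).
by move: Ex; rewrite E Ey => -[].
Qed.

Lemma guess_strings j s x : guess j s = Some x -> x \in strings j.
Proof.
rewrite /guess; case: ifP => // _ Ex.
have : x \in [seq x <- strings j | verdict M (halted j s) x s == Some true].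
  move: Ex; set l := [seq y <- strings j | _].
  by case: l => //= y l [->]; exact: mem_head.
by rewrite mem_filter => /andP[].
Qed.

Definition guessed (j : nat) : seq bits :=
  [seq x <- strings j | `[< exists s, guess j s = Some x >]].

(** The guess of length [j] is determined by the set of halted programs of length
    at most [j + c].  These sets are nested, so that each is determined by its
    size, which lies between 0 and the number of such programs that halt. *)
Lemma size_guessed j : size (guessed j) <= (count halting (strings_upto (j + c))).+1.
Proof.
(* [t x] is a stage at which [x] is guessed. *)
have /choice [t Ht] (x : bits) : exists s, x \in guessed j -> guess j s = Some x.
  case: (boolP (x \in guessed j)) => [|_]; last by exists 0.
  by rewrite mem_filter => /andP[/asboolP[s Es] _]; exists s.
pose r x := size (halted j (t x)).
have r_inj : {in guessed j &, injective r}.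
  move=> x y gx gy Er; apply: (guess_det _ (Ht _ gx) (Ht _ gy)).
  wlog le_t : x y gx gy Er / t x <= t y => [H|].
    by case: (leqP (t x) (t y)) => [/H|/ltnW/H] H'; [exact: H'|apply/esym/H'].
  have [||_ E] := uniq_min_size _ (@halted_sub j _ _ le_t) _.
  - by rewrite filter_uniq ?uniq_strings_upto.
  - by rewrite -/(r x) -/(r y) Er.
  by apply: eq_in_filter => q uq; have := E q; rewrite !mem_filter uq !andbT.
rewrite -(size_map r) -[X in _ <= X](size_iota 0); apply: uniq_leq_size.
  by rewrite map_inj_in_uniq // filter_uniq ?uniq_strings.
move=> _ /mapP[x gx ->]; rewrite mem_iota add0n ltnS /r -size_filter.
apply: uniq_leq_size; first by rewrite filter_uniq ?uniq_strings_upto.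
move=> q hq; rewrite mem_filter (halted_halting hq).
by move: hq; rewrite mem_filter => /andP[].
Qed.

(** If [M] decides the prefixes of a sequence from [dom W] and queries strings of
    length at most [j + c] on inputs of length [j], then the prefixes of that
    sequence are among these strings. *)
Definition candidates (n : nat) : seq bits :=
  [seq x <- strings n | all (fun j => take j x \in guessed j) (iota 1 n)].

Lemma count_take j n (l : seq bits) : j <= n ->
  count (fun x => take j x \in l) (strings n) <= size l * 2 ^ (n - j).
Proof.
move=> le_j; rewrite -size_filter -(size_strings (n - j)) -(size_allpairs cat).
apply: uniq_leq_size; first by rewrite filter_uniq ?uniq_strings.
move=> x; rewrite mem_filter mem_strings => /andP[lx /eqP sx].
apply/allpairsP; exists (take j x, drop j x); split=> //=; last by rewrite cat_take_drop.
by rewrite mem_strings size_drop sx.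
Qed.

(** A program [q] is counted at all levels [j >= |q| - c], where the weights
    [2^-j] add up to less than [2^(c+1)] times its own weight [2^-|q|]; Kraft's
    inequality bounds the sum of the latter. *)
Lemma sum_count_halting n :
  \sum_(j <- iota 1 n) count halting (strings_upto (j + c)) * 2 ^ (n - j) <= 2 ^ (n + c).+1.
Proof.
have pf : forall p q, halting p -> halting q -> prefix p q -> p = q.
  by move=> p q /asboolP Wp /asboolP Wq; exact: optW.1.2.
have Ecount j : j \in iota 1 n -> count halting (strings_upto (j + c)) * 2 ^ (n - j) <=
    \sum_(q <- strings_upto (n + c) | halting q) (size q - c <= j) * 2 ^ (n - j).
  rewrite mem_iota add1n ltnS => /andP[_ le_j].
  rewrite -big_distrl leq_mul2r; apply/orP; right.
  have -> : \sum_(q <- strings_upto (n + c) | halting q) (size q - c <= j) =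
      count (fun q => halting q && (size q - c <= j)) (strings_upto (n + c)).
    by rewrite -sum1_count [RHS]big_mkcondr; apply: eq_bigr => q _; case: leqP.
  rewrite -!size_filter; apply: uniq_leq_size; first by rewrite filter_uniq ?uniq_strings_upto.
  move=> q; rewrite !mem_filter !mem_strings_upto => /andP[-> /= le_q].
  by rewrite leq_subLR addnC le_q (leq_trans le_q) ?leq_add2r.
rewrite big_seq; apply: leq_trans; first by apply: leq_sum => j; exact: Ecount.
rewrite -big_seq exchange_big /=.
rewrite expnS; apply: leq_trans (leq_mul (leqnn 2) (kraft (n + c) pf)).
rewrite big_distrr /= big_seq_cond [leqRHS]big_seq_cond; apply: leq_sum => q /andP[].
rewrite mem_strings_upto => le_q _; rewrite -expnS.
apply: leq_trans (_ : 2 ^ (n.+1 - (size q - c)) <= _); last first.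
  by rewrite leq_exp2l //; move: (size q) le_q => m; clear; lia.
apply: ltnW; apply: leq_ltn_trans (sum_pow2_lt n (size q - c)).
by rewrite [leqRHS]big_mkcond; apply: leq_sum => j _; case: ifP; rewrite ?mul1n.
Qed.

(** Double counting of the pairs of a candidate and a level: each candidate has a
    guess as prefix at all [n] levels, and a guess of length [j] is a prefix of
    [2^(n - j)] strings. *)
Lemma size_candidates n : size (candidates n) * n <= 2 ^ (n + c).+2.
Proof.
have -> : size (candidates n) * n =
    \sum_(x <- candidates n) \sum_(j <- iota 1 n) (take j x \in guessed j).
  rewrite -sum1_size big_distrl /= big_seq [RHS]big_seq; apply: eq_bigr => x.
  rewrite mem_filter mul1n => /andP[/allP gx _].
  rewrite big_seq (eq_bigr (fun=> 1)) => [|j /gx ->//].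
  by rewrite -big_seq sum1_size size_iota.
rewrite exchange_big /=.
apply: leq_trans (_ : \sum_(j <- iota 1 n)
    (count halting (strings_upto (j + c)) * 2 ^ (n - j) + 2 ^ (n - j)) <= _).
  rewrite big_seq [leqRHS]big_seq; apply: leq_sum => j.
  rewrite mem_iota add1n ltnS => /andP[_ le_j].
  apply: leq_trans (_ : count (fun x => take j x \in guessed j) (strings n) <= _).
    rewrite -sum1_count /candidates big_filter [leqRHS]big_mkcond [leqLHS]big_mkcond /=.
    by apply: leq_sum => x _; case: ifP; case: (_ \in _).
  apply: leq_trans (count_take _ le_j) _.
  by rewrite addnC -mulSn leq_mul2r size_guessed orbT.
rewrite big_split /= [2 ^ _]expnS mul2n -addnn; apply: leq_add (sum_count_halting n) _.
apply: ltnW; apply: leq_trans (sum_pow2_lt n 0) _.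
by rewrite leq_exp2l //; lia.
Qed.

Definition found (n s : nat) : seq bits :=
  [seq x <- strings n |
    all (fun j => has (fun s' => guess j s' == Some (take j x)) (iota 0 s)) (iota 1 n)].

Lemma found_candidates n s : {subset found n s <= candidates n}.
Proof.
move=> x; rewrite !mem_filter => /andP[/allP fx ->]; rewrite andbT.
apply/allP => j /fx /hasP[t _ /eqP gt].
by rewrite mem_filter (guess_strings gt) andbT; apply/asboolP; exists t.
Qed.

(** New strings are only appended, so that the position of a string never changes
    and describes it. *)
Definition listing (n s : nat) : seq bits :=
  (iter s (fun w => (w.1.+1, w.2 ++ [seq x <- found n w.1 | x \notin w.2])) (0, [::])).2.

Lemma listingS n s :
  listing n s.+1 = listing n s ++ [seq x <- found n s | x \notin listing n s].
Proof.
rewrite /listing iterS; set w := iter s _ _.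
suff -> : w = (s, w.2) by [].
by rewrite /w; elim: s {w} => //= s ->.
Qed.

Lemma uniq_listing n s : uniq (listing n s).
Proof.
elim: s => [//|s IHs]; rewrite listingS cat_uniq IHs !filter_uniq ?uniq_strings // andbT.
by apply/hasPn => x; rewrite mem_filter => /andP[].
Qed.

Lemma listing_candidates n s : {subset listing n s <= candidates n}.
Proof.
elim: s => [//|s IHs] x; rewrite listingS mem_cat => /orP[/IHs//|].
by rewrite mem_filter => /andP[_ /found_candidates].
Qed.

Lemma found_listing n s : {subset found n s <= listing n s.+1}.
Proof.
move=> x fx; rewrite listingS mem_cat mem_filter fx andbT.
by case: (x \in listing n s).
Qed.

Lemma nth_listing n s s' i : s <= s' -> i < size (listing n s) ->
  i < size (listing n s') /\ nth [::] (listing n s') i = nth [::] (listing n s) i.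
Proof.
move=> /subnK <- lt_i; elim: (s' - s) => [//|k [lt_k <-]].
by rewrite addSn listingS size_cat nth_cat lt_k ltn_addr.
Qed.

Lemma computable_listing : computable (fun p => listing p.1 p.2).
Proof.
have [Cst _ _] := Hst.
have Cs : computable strings by apply: computable_strings; comp.
have Cup : computable strings_upto by apply: computable_strings_upto; comp.
have Cv : computable (fun p => verdict M p.1.1 p.1.2 p.2).
  by apply: computable_verdict; comp.
have Ch : computable (fun p => halted p.1 p.2) by rewrite /halted; comp.
have Cg : computable (fun p => guess p.1 p.2) by rewrite /guess; comp.
have Cf : computable (fun p => found p.1 p.2) by rewrite /found; comp.
by rewrite /listing; comp.
Qed.

(** Once all halting programs of length at most [j + c] have halted, the machine
    gives the true answers, and accepts a single string of length [j]. *)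
Lemma guess_correct (A : set bits) (b : nat -> bool) j :
  turing_reduces_via M A (dom W) ->
  (forall x u, queries M (dom W) x u -> size u <= size x + c) ->
  (forall x, A x <-> x = mkseq b (size x)) ->
  exists s, guess j s = Some (mkseq b j).
Proof.
move=> red le_c HA; pose D := [seq q <- strings_upto (j + c) | halting q].
have [t1 H1] : exists t, forall t', t <= t' -> forall x, x \in strings j ->
    verdict M D x t' = Some `[< A x >].
  apply: eventually_all => x; rewrite mem_strings => /eqP sx.
  apply: (verdict_reduces red (le_c x)) => u; rewrite sx => le_u.
  rewrite mem_filter mem_strings_upto le_u andbT.
  by split=> [/asboolP|/asboolP].
have [t2 H2] := stage_eventually (strings_upto (j + c)) Hst.
exists (maxn t1 t2); rewrite /guess.
have -> : halted j (maxn t1 t2) = D.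
  apply: eq_in_filter => q uq; apply/idP/idP => [sq|hq].
    by apply: (@halted_halting j (maxn t1 t2)); rewrite mem_filter sq.
  by apply: (H2 _ (leq_maxr _ _)) => //; apply/asboolP.
have H x := H1 _ (leq_maxl t1 t2) x.
case: ifP => [_|/negP[]]; last by apply/allP => x /H ->.
have -> : [seq x <- strings j | verdict M D x (maxn t1 t2) == Some true] =
    [seq x <- strings j | x == mkseq b j].
  apply: eq_in_filter => x jx; rewrite (H _ jx); rewrite mem_strings in jx.
  apply/eqP/eqP => [[/asboolP/HA]|->]; first by rewrite (eqP jx).
  by congr Some; apply/asboolP/HA; rewrite size_mkseq.
rewrite filter_pred1_uniq ?uniq_strings //.
by rewrite mem_strings size_mkseq.
Qed.

End Guesses.

(** The certificate is the position of a truncation of [Omega V] in the listing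
    of the candidates of length [n = 4^e], written with [n + c + 2 - 2e] bits:
    enough by [size_candidates], and too few for large [e]. *)
Lemma omega_query_size (R : realType) V W g : optimal V -> optimal W ->
  reducible_in_query_size g (Pf (Omega R V)) (dom W) -> forall c, exists n, n + c < g n.
Proof.
move=> optV optW [M [red le_g]] c; apply: contrapT => small_g.
have g_le n : g n <= n + c by rewrite leqNgt; apply/negP => lt_n; apply: small_g; exists n.
have [stW HW] := partial_recursive_stage optW.1.1.
have [stV HV] := partial_recursive_stage optV.1.1; have [CV MV EV] := HV.
have [b tb Pfb] := Pf_spec (Omega R V).
(* [Pf] only sees the fractional part of [Omega V], so the description contains
   the integral part [z] as a constant. *)
pose z := `|Num.floor (Omega R V)|%N.
have Ez : (z%:R : R)%R = ((Num.floor (Omega R V))%:~R)%R.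
  have : (0 <= Num.floor (Omega R V))%R.
    by rewrite Num.Theory.floor_ge0 Omega_ge0 //; exact: optV.1.2.
  by rewrite /z; case: (Num.floor _).
pose len e := 4 ^ e.
(* The string [tau] of length [wid e] denotes its index among the strings of its
   length, and [sigma e tau s] is the listed string at that position. *)
pose wid e := (len e + c).+2 - (e + e).
pose list := listing M stW c.
pose weightV s := sumn [seq 2 ^ (s - size q) | q <- strings_upto s & isSome (stV q s)].
pose sigma e tau s := nth [::] (list (len e) s) (index tau (strings (wid e))).
pose ready e tau s :=
  if [&& size tau == wid e, index tau (strings (wid e)) < size (list (len e) s)
       & (z * 2 ^ len e + binval (sigma e tau s)) * 2 ^ s < weightV s * 2 ^ len e + 2 ^ s]
  then Some (len e) else None.
have Cready : computable (fun p => ready p.1.1 p.1.2 p.2).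
  have Cl : computable (fun p => list p.1 p.2) by exact: (computable_listing M c HW).
  have Cs : computable strings by apply: computable_strings; comp.
  have Cup : computable strings_upto by apply: computable_strings_upto; comp.
  have Cb : computable binval.
    apply: (@computable_ext _ _ _ _
      (foldl (fun m (b : bool) => m + m + nat_of_bool b) 0)).
      by move=> x; rewrite /binval; elim: x 0 => //= a x IHx m; rewrite IHx addnn.
    by comp; apply: computable_nat_of_bool; comp.
  by rewrite /ready /sigma /weightV /wid /len; comp.
have Hlen e tau tau' s s' : ready e tau s -> ready e tau' s' -> size tau = size tau'.
  rewrite /ready; case: ifP => // /and3P[/eqP -> _ _] _.
  by case: ifP => // /and3P[/eqP -> _ _].
have [d Hd] := no_short_certificate optV HV Cready Hlen.
(* Large enough for [n <= e + wid e + d] to fail. *)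
pose e := (c + d).+3; pose n := len e; pose x := mkseq b n.
have E4 : len e = 2 ^ (e + e) by rewrite /len -[4]/(2 ^ 2) -expnM mul2n addnn.
have le_e : e + e <= n.
  have H k : k + k <= 2 ^ k * 2 ^ k.
    by have := ltn_expl k (ltnSn 1); move: (2 ^ k) => p; nia.
  by rewrite /n E4 expnD.
have [s1 fx] : exists s, x \in found M stW c n s.
  have /eventually_all [t Ht] j : j \in iota 1 n ->
      exists t, forall t', t <= t' -> exists2 s, s < t' & guess M stW c j s = Some (mkseq b j).
    move=> _; have [|s Es] := guess_correct (c := c) HW j red _ Pfb.
      by move=> y u /le_g le_u; exact: leq_trans le_u (g_le _).
    by exists s.+1 => t' lt_s; exists s.
  exists t; rewrite mem_filter mem_strings size_mkseq eqxx andbT.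
  apply/allP => j jn; have [s lt_s Es] := Ht t (leqnn t) j jn.
  apply/hasP; exists s; rewrite ?mem_iota // Es.
  move: jn; rewrite mem_iota add1n ltnS => /andP[_ le_j].
  by rewrite /x /mkseq -map_take take_iota (minn_idPl le_j).
have lx : x \in list n s1.+1 by exact: found_listing.
pose i := index x (list n s1.+1).
have lt_i : i < size (list n s1.+1) by rewrite index_mem.
have nth_i s : s1 < s -> i < size (list n s) /\ nth [::] (list n s) i = x.
  move=> le_s; have [lt_s ->] := nth_listing le_s lt_i.
  by split=> //; exact: nth_index.
have lt_i2 : i < size (strings (wid e)).
  rewrite size_strings; apply: leq_trans lt_i _.
  apply: (leq_trans (uniq_leq_size (uniq_listing _ _ _ _ _)
    (@listing_candidates M stW c n s1.+1))).
  have := size_candidates M c optW HW n.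
  have -> : (n + c).+2 = wid e + (e + e) by rewrite /wid -/n; lia.
  by rewrite expnD -E4 leq_pmul2r // /n E4 expn_gt0.
pose tau := nth [::] (strings (wid e)) i.
have size_tau : size tau = wid e by apply/eqP; rewrite -mem_strings mem_nth.
have index_tau : index tau (strings (wid e)) = i by rewrite index_uniq ?uniq_strings.
pose k := z * 2 ^ n + binval x.
have Ek : (k%:R <= Omega R V * 2 ^+ n < k.+1%:R)%R.
  have := tb n; rewrite -Ez mulrBl -/x /k -[X in _ -> (_ <= _ < X)%R]natr1 natrD natrM natrX.
  by rewrite -[in X in X -> _]natr1; lra.
have weightE s : weightV s = stage_weight stV s.
  by rewrite /weightV /stage_weight /mass sumnE big_map big_filter.
have [s2 H2] : exists t, forall s, t <= s -> k * 2 ^ s < stage_weight stV s * 2 ^ n + 2 ^ s.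
  by have /andP[le_k _] := Ek; exact: (Omega_approached optV.1.2 HV le_k).
have [||s [N [HN le_N]]] := Hd e tau (maxn s1.+1 s2).
- have [lt_s Ex] := nth_i _ (leq_maxl s1.+1 s2).
  rewrite /ready size_tau eqxx index_tau lt_s /sigma index_tau Ex weightE.
  by rewrite -/n -/k H2 ?leq_maxr.
- move=> s N; rewrite /ready size_tau eqxx index_tau /sigma index_tau -/n weightE /=.
  case: ifP => // /andP[lt_s lt_k] [<-]; have /andP[_ lt_Omega] := Ek.
  suff Ex : nth [::] (list n s) i = x.
    by rewrite Ex in lt_k; exact: (Omega_settles optV.1.2 HV lt_Omega).
  have [_ <-] := nth_i _ (leq_maxl s1.+1 s).
  by have [_ ->] := nth_listing (leq_maxr s1.+1 s) lt_s.
move: HN le_N; rewrite /ready; case: ifP => // _ [<-]; rewrite size_tau /wid -/n.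
by rewrite /e; move: le_e; rewrite /e; lia.
Qed.

(** * Unidirectionality *)

Theorem theorem4p3 (R : realType) (V W : seq bool -> option (seq bool))
    (hV : optimal V) (hW : optimal W) :
  unidirectional (Pf (Omega R V)) (dom W) /\
  unidirectional (dom W) (Pf (Omega R V)).
Proof.
have unbounded_above (h : nat -> nat) : (forall c, exists n, n + c < h n) ->
    unbounded (fun n => (h n)%:Z - n%:Z)%R.
  by move=> H c; have [n lt_n] := H c; exists n; lia.
split=> f g [monof recf _] [monog recg _] redf redg; apply: unbounded_above => c.
- have [d Hd] := halting_query_size hW monof recf redf.
  have [n lt_n] := omega_query_size hV hW redg (d + c).
  exists (n + d); have := Hd (n + d); rewrite leq_add2r => /monog.
  by apply: leq_trans; rewrite -addnA.
- have [d Hd] := halting_query_size hW monog recg redg.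
  have [n lt_n] := omega_query_size hV hW redf (c + d).
  exists n; have := Hd (f n); move: lt_n; lia.
Qed.
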